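(* Let $\mathcal{A}$ be a nonzero $C^*$-algebra and let $x$ and $y$ be two elements of a pre-Hilbert $\mathcal{A}$-module. The following statements are equivalent: (i) $\||x|^2+|y|^2\|=\|x\|^2+\|y\|^2$. (ii) $\||x||y|\|=\|x\|\|y\|$. (iii) $S_{|x|^2}(\mathcal{A})\cap S_{|y|^2}(\mathcal{A})\neq\emptyset$. (iv) $\|x\|^2\|y\|^2\in V(|x|^2|y|^2)$. (v) $\|x\|^2+\|y\|^2\in V(|x|^2+|y|^2)$.
   Context: A (right) pre-Hilbert $\mathcal{A}$-module $\mathscr{E}$ is a complex linear space that is a right $\mathcal{A}$-module with compatible scalar multiplication, equipped with an $\mathcal{A}$-valued inner product $\langle\cdot,\cdot\rangle$ (conjugate-linear in the first and linear in the second variable) such that $\langle x,x\rangle\ge 0$ with equality iff $x=0$, $\langle x,y\rangle^*=\langle y,x\rangle$, and $\langle x,ya\rangle=\langle x,y\rangle a$. Completeness is not assumed. For $x\in\mathscr{E}$, $|x|:=\langle x,x\rangle^{1/2}\in\mathcal{A}$ and $\|x\|:=\||x|\|_{\mathcal{A}}$. $S(\mathcal{A})$ is the set of states of $\mathcal{A}$; for $a\in\mathcal{A}$, $V(a)=\{\varphi(a):\varphi\in S(\mathcal{A})\}$ and $S_a(\mathcal{A})=\{\varphi\in S(\mathcal{A}):|\varphi(a)|=\|a\|\}$. *)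

(* Defs.v *)
From HB Require Import structures.
From mathcomp Require Import all_boot all_order all_algebra.
From mathcomp Require Import all_classical all_reals all_analysis.
From mathcomp Require Export complex.

Set Implicit Arguments.
Unset Strict Implicit.
Unset Printing Implicit Defensive.

Import Order.TTheory GRing.Theory Num.Theory.
Import numFieldNormedType.Exports.

Local Open Scope classical_set_scope.
Local Open Scope ring_scope.
Local Open Scope complex_scope.

Declare Scope cstar_scope.
Delimit Scope cstar_scope with cstar.
Reserved Notation "a ** b" (at level 40, left associativity).

(* C*-algebras are not assumed unital, so the product is not a ring
   multiplication of the algebraic hierarchy.  The scalars are R[i], and norms
   `|a| take (nonnegative real) values in R[i]; in R[i], 0 <= z means that z is
   real and nonnegative. *)
HB.mixin Record isCStarAlgebra (R : realType) A
    of CompleteNormedModule R[i] A := {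
  cmul : A -> A -> A ;
  cstar : A -> A ;
  cmulA : associative cmul ;
  cmul_linearr : forall a : A, linear (cmul a) ;
  cmul_linearl : forall b : A, linear (cmul^~ b) ;
  cstarK : involutive cstar ;
  cstar_semilinear : forall (k : R[i]) (a b : A),
    cstar (k *: a + b) = Num.conj k *: cstar a + cstar b ;
  cstarM : forall a b : A, cstar (cmul a b) = cmul (cstar b) (cstar a) ;
  normrM_le : forall a b : A, `|cmul a b| <= `|a| * `|b| ;
  normr_cstar : forall a : A, `|cmul (cstar a) a| = `|a| ^+ 2 }.

#[short(type="cstarAlgType")]
HB.structure Definition CStarAlgebra (R : realType) :=
  { A of CompleteNormedModule R[i] A & isCStarAlgebra R A }.

Notation "a ** b" := (cmul a b) : cstar_scope.
Local Open Scope cstar_scope.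

Section CStarAlgebraDefs.
Variables (R : realType) (A : cstarAlgType R).
Implicit Types (a b : A) (phi : {scalar A}).

Definition cpos a : Prop := exists b, a = cstar b ** b.

(* The positive square root is unique when it exists, that is, when a is
   positive; the value is 0 otherwise. *)
Definition csqrt a : A := xget 0 [set b | cpos b /\ b ** b = a].

Definition csqr a : A := a ** a.

Definition positive_functional phi : Prop := forall a, cpos a -> 0 <= phi a.

(* The least upper bound is the operator norm of phi, so this says ||phi|| = 1;
   an upper bound in R[i] of a set of norms is automatically real. *)
Definition states : set {scalar A} :=
  [set phi | positive_functional phi /\
     isLub [set `|phi a| | a in [set a | `|a| <= 1]] 1].

Definition num_range a : set R[i] := [set phi a | phi in states].

Definition norming_states a : set {scalar A} :=
  [set phi | states phi /\ `|phi a| = `|a|].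

End CStarAlgebraDefs.

HB.mixin Record isPreHilbertModule (R : realType) (A : cstarAlgType R) E
    of GRing.Lmodule R[i] E := {
  ract : E -> A -> E ;
  inner : E -> E -> A ;
  ract_linearr : forall x : E, linear (ract x) ;
  ract_linearl : forall a : A, linear (ract^~ a) ;
  ractM : forall (x : E) (a b : A), ract x (a ** b) = ract (ract x a) b ;
  inner_linearr : forall x : E, linear (inner x) ;
  inner_ract : forall (x y : E) (a : A), inner x (ract y a) = inner x y ** a ;
  cstar_inner : forall x y : E, cstar (inner x y) = inner y x ;
  inner_pos : forall x : E, cpos (inner x x) ;
  inner_eq0 : forall x : E, inner x x = 0 -> x = 0 }.

(* Conjugate-linearity in the first variable follows from inner_linearr,
   cstar_inner and cstar_semilinear. *)
#[short(type="preHilbertModType")]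
HB.structure Definition PreHilbertModule (R : realType) (A : cstarAlgType R) :=
  { E of GRing.Lmodule R[i] E & isPreHilbertModule R A E }.

Section PreHilbertModuleDefs.
Variables (R : realType) (A : cstarAlgType R) (E : preHilbertModType A).

Definition mabs (x : E) : A := csqrt (inner x x).

Definition mnorm (x : E) : R[i] := `|mabs x|.

End PreHilbertModuleDefs.

(* Main.v *)
Require Import Defs.
From mathcomp Require Import all_boot all_order all_algebra.
From mathcomp Require Import all_classical all_reals all_analysis.
From mathcomp Require Import ring lra.
From HB Require Import structures.

(* Only the self-adjoint elements p = |x| and q = |y| matter. If
   ||p^2 + q^2|| = ||p||^2 + ||q||^2, then a state attaining the norm of the
   positive element p^2 + q^2 must attain the norms of both p^2 and q^2.
   Conversely, normalise ||p|| = ||q|| = 1 and let phi be a state with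
   phi(p^2) = phi(q^2) = 1. For m = (p^2 + q^2) / 2 one has
   ||2 m - m^2|| = ||1 - (1 - m)^2|| <= 1, so phi(m^2) >= 1; expanding m^2, each
   of the four terms of phi(4 m^2) is at most 1 in modulus, so phi(p^2 q^2) = 1.
   This gives ||p q|| = 1 as p^2 q^2 = p (p q) q. Finally, if ||p q|| = 1 and
   t = ||p^2 + q^2||, then q (t - p^2 - q^2) q >= 0 yields
   q p^2 q <= t q^2 - q^4 <= t^2 / 4, hence t >= 2.
   Norm-attaining states come from the Hahn-Banach theorem and the positivity of
   a^* a (Fukamiya, Kaplansky), proved in the unitization of A, where square
   roots are obtained by a norm-convergent iteration. *)

Set Implicit Arguments.
Unset Strict Implicit.
Unset Printing Implicit Defensive.

Import Order.TTheory GRing.Theory Num.Theory.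
Import numFieldNormedType.Exports.

Local Open Scope classical_set_scope.
Local Open Scope ring_scope.
Local Open Scope complex_scope.
Local Open Scope cstar_scope.

(** * The unitization *)

Section RealNorm.
Variable R : realType.

(** Norms live in [R[i]] but are real by [rnormE]; the real copy gives access to infima, square
    roots and real arithmetic. *)
Definition rnorm (V : normedZmodType R[i]) (v : V) : R := complex.Re `|v|.

Section Normed.
Variable V : normedZmodType R[i].
Implicit Types u v : V.

Lemma rnormE v : `|v| = (rnorm v)%:C.
Proof.
rewrite /rnorm; have := normr_ge0 v; case: `|v| => a b /=.
by rewrite lecE /= => /andP[/eqP -> _].
Qed.

Lemma rnorm_ge0 v : 0 <= rnorm v.
Proof. by rewrite -ler0c -rnormE. Qed.

Lemma rnormD u v : rnorm (u + v) <= rnorm u + rnorm v.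
Proof. by rewrite -lecR rmorphD /= -!rnormE ler_normD. Qed.

Lemma rnormN v : rnorm (- v) = rnorm v.
Proof. by rewrite /rnorm normrN. Qed.

Lemma rnorm0 : rnorm (0 : V) = 0.
Proof. by rewrite /rnorm normr0. Qed.

Lemma rnorm0_eq0 v : rnorm v = 0 -> v = 0.
Proof. by move=> v0; apply/normr0_eq0; rewrite rnormE v0. Qed.

End Normed.

Lemma rnormZ (V : normedModType R[i]) k (v : V) :
  rnorm (k *: v) = rnorm k * rnorm v.
Proof. by apply: (@complexI R); rewrite rmorphM /= -!rnormE normrZ. Qed.

Lemma rnormM (k l : R[i]) : rnorm (k * l) = rnorm k * rnorm l.
Proof. by apply: (@complexI R); rewrite rmorphM /= -!rnormE normrM. Qed.

Lemma rnormC (r : R) : rnorm r%:C = `|r|.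
Proof. by rewrite /rnorm normc_def /= expr0n /= addr0 sqrtr_sqr. Qed.

Lemma rnorm_Re (k : R[i]) : complex.Re k <= rnorm k.
Proof.
rewrite /rnorm normc_def /=; case: k => a b /=.
apply: le_trans (ler_norm a) _.
by rewrite -sqrtr_sqr ler_wsqrtr // lerDl sqr_ge0.
Qed.

Lemma rnorm_conj (k : R[i]) : rnorm (Num.conj k) = rnorm k.
Proof. by rewrite /rnorm norm_conjC. Qed.

End RealNorm.

(** * Elementary rules for product and involution *)

Section CStarTheory.
Variables (R : realType) (A : cstarAlgType R).
Implicit Types (a b c : A) (k : R[i]).

Lemma cmulDr a b c : a ** (b + c) = a ** b + a ** c.
Proof. by rewrite -{1}(scale1r b) cmul_linearr scale1r. Qed.

Lemma cmulDl a b c : (a + b) ** c = a ** c + b ** c.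
Proof. by rewrite -{1}(scale1r a) cmul_linearl scale1r. Qed.

Lemma cmul0 a : a ** 0 = 0.
Proof. by apply: (addrI (a ** 0)); rewrite -cmulDr !addr0. Qed.

Lemma cmul0l a : 0 ** a = 0.
Proof. by apply: (addrI (0 ** a)); rewrite -cmulDl !addr0. Qed.

Lemma cmulZr k a b : a ** (k *: b) = k *: (a ** b).
Proof. by have := cmul_linearr a k b 0; rewrite /= !addr0 cmul0 addr0. Qed.

Lemma cmulZl k a b : (k *: a) ** b = k *: (a ** b).
Proof. by have := cmul_linearl b k a 0; rewrite /= !addr0 cmul0l addr0. Qed.

Lemma cstarD a b : cstar (a + b) = cstar a + cstar b.
Proof. by rewrite -{1}(scale1r a) cstar_semilinear conjC1 scale1r. Qed.

Lemma cstar0 : cstar (0 : A) = 0.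
Proof. by apply: (addrI (cstar 0)); rewrite -cstarD !addr0. Qed.

Lemma cstarZ k a : cstar (k *: a) = Num.conj k *: cstar a.
Proof. by rewrite -[k *: a]addr0 cstar_semilinear cstar0 addr0. Qed.

Lemma rnorm_cmul a b : rnorm (a ** b) <= rnorm a * rnorm b.
Proof. by rewrite -lecR rmorphM /= -!rnormE normrM_le. Qed.

Lemma rnorm_cstar2 a : rnorm (cstar a ** a) = rnorm a ^+ 2.
Proof. by apply: (@complexI R); rewrite rmorphXn /= -!rnormE normr_cstar. Qed.

(** From ||b||^2 = ||b^* b|| <= ||b^*|| ||b|| follows ||b|| <= ||b^*||; the converse is the case of
    b^*. *)
Lemma rnorm_cstar a : rnorm (cstar a) = rnorm a.
Proof.
have le b : rnorm b <= rnorm (cstar b).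
  have := rnorm_cmul (cstar b) b; rewrite rnorm_cstar2.
  by have := rnorm_ge0 b; have := rnorm_ge0 (cstar b); nra.
by apply/eqP; rewrite eq_le le andbT -{2}(cstarK a) le.
Qed.

End CStarTheory.

(* The scalar modulus is part of the norm below, so that the unitization carries
   a norm even when A already has a unit. *)
Definition unitization (R : realType) (A : cstarAlgType R) : Type :=
  (R[i] * A)%type.

Section Unitization.
Variables (R : realType) (A : cstarAlgType R).
Local Notation U := (unitization A).

HB.instance Definition _ := GRing.Lmodule.copy U (R[i] * A)%type.

Implicit Types (x y z : U) (a b c : A).

(** The pair [(k, a)] stands for the formal sum k 1 + a. *)
Definition umul x y : U :=
  (x.1 * y.1, x.1 *: y.2 + y.1 *: x.2 + x.2 ** y.2).

Definition uone : U := (1, 0).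

Lemma umulA : associative umul.
Proof.
move=> [k a] [l b] [m c]; rewrite /umul /=; congr (_, _); first by rewrite mulrA.
rewrite !(scalerDr, cmulDr, cmulDl, cmulZr, cmulZl, scalerA, cmulA) !addrA.
rewrite [m * k]mulrC [m * l]mulrC.
by rewrite [LHS](ACl (1*2*4*6*3*5*7)).
Qed.

Lemma umul1l : left_id uone umul.
Proof.
by case=> k a; rewrite /umul /= mul1r scale1r scaler0 cmul0l !addr0.
Qed.

Lemma umul1r : right_id uone umul.
Proof.
by case=> k a; rewrite /umul /= mulr1 scale1r scaler0 cmul0 addr0 add0r.
Qed.

Lemma umulDl : left_distributive umul +%R.
Proof.
move=> [k a] [l b] [m c]; rewrite /umul /=; congr (_, _); first by rewrite mulrDl.
rewrite scalerDl scalerDr cmulDl.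
by rewrite [LHS](AC (2*2*2) ((1*3*5)*(2*4*6))).
Qed.

Lemma umulDr : right_distributive umul +%R.
Proof.
move=> [k a] [l b] [m c]; rewrite /umul /=; congr (_, _); first by rewrite mulrDr.
rewrite scalerDl scalerDr cmulDr.
by rewrite [LHS](AC (2*2*2) ((1*3*5)*(2*4*6))).
Qed.

Lemma uone_neq0 : uone != 0.
Proof. by apply/eqP => -[] /eqP; rewrite oner_eq0. Qed.

HB.instance Definition _ := GRing.Zmodule_isNzRing.Build U
  umulA umul1l umul1r umulDl umulDr uone_neq0.

Lemma uscaleAl (k : R[i]) x y : k *: (x * y) = (k *: x) * y.
Proof.
case: x y => [l a] [m b]; congr (_, _) => /=; first exact: mulrA.
by rewrite !(scalerDr, cmulZl, scalerA) [k * m]mulrC.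
Qed.

HB.instance Definition _ := GRing.Lmodule_isLalgebra.Build R[i] U uscaleAl.

Lemma uscaleAr (k : R[i]) x y : k *: (x * y) = x * (k *: y).
Proof.
case: x y => [l a] [m b]; congr (_, _) => /=; first exact: mulrCA.
by rewrite !(scalerDr, cmulZr, scalerA) [k * l]mulrC.
Qed.

HB.instance Definition _ := GRing.Lalgebra_isAlgebra.Build R[i] U uscaleAr.

Definition ustar x : U := (Num.conj x.1, cstar x.2).

Definition uemb a : U := (0, a).

Lemma ustarK : involutive ustar.
Proof. by case=> k a; rewrite /ustar /= conjCK cstarK. Qed.

Lemma ustarD x y : ustar (x + y) = ustar x + ustar y.
Proof. by rewrite /ustar /= rmorphD cstarD. Qed.

Lemma ustarZ k x : ustar (k *: x) = Num.conj k *: ustar x.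
Proof. by rewrite /ustar /= rmorphM cstarZ. Qed.

Lemma ustarZr (r : R) x : ustar (r%:C *: x) = r%:C *: ustar x.
Proof. by rewrite ustarZ conj_Creal // complex_real. Qed.

Lemma ustarN x : ustar (- x) = - ustar x.
Proof. by rewrite -scaleN1r ustarZ rmorphN1 scaleN1r. Qed.

Lemma ustarB x y : ustar (x - y) = ustar x - ustar y.
Proof. by rewrite ustarD ustarN. Qed.

Lemma ustarM x y : ustar (x * y) = ustar y * ustar x.
Proof.
case: x y => [l a] [m b]; congr (_, _) => /=; first by rewrite rmorphM mulrC.
by rewrite !cstarD !cstarZ cstarM [X in X + _]addrC.
Qed.

Lemma ustar1 : ustar 1 = 1.
Proof. by congr (_, _); rewrite /= ?conjC1 ?cstar0. Qed.

Lemma uembD a b : uemb (a + b) = uemb a + uemb b.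
Proof. by congr (_, _); rewrite /= addr0. Qed.

Lemma uembZ k a : uemb (k *: a) = k *: uemb a.
Proof. by congr (_, _) => /=; rewrite scaler0. Qed.

Lemma uembN a : uemb (- a) = - uemb a.
Proof. by rewrite -scaleN1r uembZ scaleN1r. Qed.

Lemma uembM a b : uemb (a ** b) = uemb a * uemb b.
Proof. by congr (_, _); rewrite /= ?mulr0 // !scale0r !add0r. Qed.

Lemma ustar_emb a : ustar (uemb a) = uemb (cstar a).
Proof. by congr (_, _); rewrite /= conjC0. Qed.

Lemma uemb_inj : injective uemb.
Proof. by move=> a b []. Qed.

(** Left multiplication by k 1 + a, which preserves [A] because [A] is an ideal of its
    unitization. *)
Definition uact x b : A := x.1 *: b + x.2 ** b.

Lemma uactM x y b : uact (x * y) b = uact x (uact y b).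
Proof.
rewrite /uact /= !(scalerDr, cmulDr, cmulDl, cmulZr, cmulZl, scalerA, cmulA).
by rewrite !addrA.
Qed.

Lemma uactD x y b : uact (x + y) b = uact x b + uact y b.
Proof. by rewrite /uact /= scalerDl cmulDl addrACA. Qed.

Lemma uactZ k x b : uact (k *: x) b = k *: uact x b.
Proof. by rewrite /uact /= scalerDr cmulZl scalerA. Qed.

Lemma cstar_uact x b c : cstar (uact x b) ** c = cstar b ** uact (ustar x) c.
Proof.
by rewrite /uact /= cstarD cstarZ cstarM cmulDl cmulDr cmulZl cmulZr cmulA.
Qed.

(** The least of these bounds is the larger of the modulus of the scalar part and the operator norm
    of [uact x]. *)
Definition ubounds x : set R :=
  [set t | rnorm x.1 <= t /\ forall b, rnorm (uact x b) <= t * rnorm b].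

Definition unorm x : R := inf (ubounds x).

Lemma ubounds_has_inf x : has_inf (ubounds x).
Proof.
split; last by exists 0 => t [/(le_trans (rnorm_ge0 _))].
exists (rnorm x.1 + rnorm x.2); split; first by rewrite lerDl rnorm_ge0.
move=> b; rewrite mulrDl; apply: le_trans (rnormD _ _) _.
by rewrite rnormZ lerD2l rnorm_cmul.
Qed.

Lemma unorm_le x t :
  rnorm x.1 <= t -> (forall b, rnorm (uact x b) <= t * rnorm b) -> unorm x <= t.
Proof. by move=> h1 h2; apply: ge_inf => //; case: (ubounds_has_inf x). Qed.

Lemma unorm_scal x : rnorm x.1 <= unorm x.
Proof. by apply: lb_le_inf => [|t []//]; case: (ubounds_has_inf x). Qed.

Lemma unorm_ge0 x : 0 <= unorm x.
Proof. exact: le_trans (rnorm_ge0 _) (unorm_scal x). Qed.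

Lemma unorm_act x b : rnorm (uact x b) <= unorm x * rnorm b.
Proof.
have [b0|b_neq0] := eqVneq (rnorm b) 0.
  by rewrite (rnorm0_eq0 b0) /uact scaler0 cmul0 addr0 rnorm0 mulr0.
have b_gt0 : 0 < rnorm b by rewrite lt_def b_neq0 rnorm_ge0.
rewrite -ler_pdivrMr //; apply: lb_le_inf => [|t [_ ht]].
  by case: (ubounds_has_inf x).
by rewrite ler_pdivrMr.
Qed.

(** The lower bound comes from acting on a^*, since ||a a^*|| = ||a||^2 and ||a^*|| = ||a||. *)
Lemma unorm_emb a : unorm (uemb a) = rnorm a.
Proof.
have act b : uact (uemb a) b = a ** b by rewrite /uact /= scale0r add0r.
apply/eqP; rewrite eq_le; apply/andP; split.
  apply: unorm_le => [|b]; first by rewrite rnorm0 rnorm_ge0.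
  by rewrite act rnorm_cmul.
have := unorm_act (uemb a) (cstar a).
rewrite act -{1}(cstarK a) rnorm_cstar2 rnorm_cstar.
by have := rnorm_ge0 a; have := unorm_ge0 (uemb a); nra.
Qed.

Lemma unormD x y : unorm (x + y) <= unorm x + unorm y.
Proof.
apply: unorm_le => [|b].
  by apply: le_trans (rnormD _ _) _; rewrite lerD ?unorm_scal.
by rewrite uactD mulrDl; apply: le_trans (rnormD _ _) _; rewrite lerD ?unorm_act.
Qed.

Lemma unormM x y : unorm (x * y) <= unorm x * unorm y.
Proof.
apply: unorm_le => [|b].
  by rewrite rnormM ler_pM ?unorm_scal ?rnorm_ge0.
rewrite uactM -mulrA; apply: le_trans (unorm_act _ _) _.
by rewrite ler_wpM2l ?unorm_act ?unorm_ge0.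
Qed.

Lemma unormZ k x : unorm (k *: x) = rnorm k * unorm x.
Proof.
have le l y : unorm (l *: y) <= rnorm l * unorm y.
  apply: unorm_le => [|b].
    by rewrite rnormM ler_wpM2l ?unorm_scal ?rnorm_ge0.
  by rewrite uactZ rnormZ -mulrA ler_wpM2l ?unorm_act ?rnorm_ge0.
have [->|k0] := eqVneq k 0.
  apply/eqP; rewrite eq_le le rnorm0 mul0r.
  exact: unorm_ge0.
apply/eqP; rewrite eq_le le /=.
have k_gt0 : 0 < rnorm k.
  by rewrite lt_def rnorm_ge0 andbT; apply: contra_neq k0 => /rnorm0_eq0.
rewrite mulrC -ler_pdivlMr //.
rewrite -{1}[x]scale1r -(mulVf k0) -scalerA; apply: le_trans (le _ _) _.
rewrite mulrC ler_wpM2l ?unorm_ge0 //.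
rewrite -[rnorm k^-1]mul1r -(mulVf (lt0r_neq0 k_gt0)) -mulrA -rnormM mulfV //.
by rewrite -[1]/(1%:C) rnormC normr1 mulr1.
Qed.

Lemma unormZr (r : R) x : unorm (r%:C *: x) = `|r| * unorm x.
Proof. by rewrite unormZ rnormC. Qed.

Lemma unormN x : unorm (- x) = unorm x.
Proof. by rewrite -scaleN1r unormZ rnormN -[1]/(1%:C) rnormC normr1 mul1r. Qed.

Lemma unormB x y : unorm (x - y) <= unorm x + unorm y.
Proof. by rewrite -(unormN y) unormD. Qed.

Lemma unorm1 : unorm 1 = 1.
Proof.
have r1 : rnorm (1 : R[i]) = 1 by rewrite -[1]/(1%:C) rnormC normr1.
apply/eqP; rewrite eq_le; apply/andP; split; last first.
  by rewrite -{1}r1; exact: (unorm_scal 1).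
apply: unorm_le => [|b]; first by rewrite /= r1.
by rewrite /uact /= scale1r cmul0l addr0 mul1r.
Qed.

Lemma unorm0_eq0 x : unorm x = 0 -> x = 0.
Proof.
case: x => k a x0; have := unorm_scal (k, a); rewrite x0 /= => k0.
have {}k0 : k = 0.
  by apply: rnorm0_eq0; apply/eqP; rewrite eq_le k0 rnorm_ge0.
by rewrite k0 -/(uemb a) unorm_emb in x0 *; rewrite (rnorm0_eq0 x0).
Qed.

Lemma ustar0 : ustar 0 = 0.
Proof. by rewrite -(scale0r 1) ustarZ conjC0 !scale0r. Qed.

Lemma unorm0 : unorm 0 = 0.
Proof. by rewrite -(scale0r 1) unormZ rnorm0 mul0r. Qed.

(** The C*-identity of [A] gives ||x b||^2 = ||b^* (x^* x b)|| <= ||x^* x|| ||b||^2; the scalar part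
    k satisfies |k|^2 = |conj(k) k|. *)
Lemma unorm_sqr_le x : unorm x ^+ 2 <= unorm (ustar x * x).
Proof.
set t := unorm (ustar x * x).
have t0 : 0 <= t := unorm_ge0 _.
suff : unorm x <= Num.sqrt t.
  by move=> h; rewrite -[t]sqr_sqrtr // lerXn2r ?nnegrE ?sqrtr_ge0 ?unorm_ge0.
apply: unorm_le => [|b].
  rewrite -[rnorm x.1]ger0_norm ?rnorm_ge0 // -sqrtr_sqr.
  apply: ler_wsqrtr; apply: le_trans (unorm_scal _).
  by rewrite rnormM rnorm_conj expr2.
have le2 : rnorm (uact x b) ^+ 2 <= t * rnorm b ^+ 2.
  rewrite -rnorm_cstar2 cstar_uact -uactM.
  apply: le_trans (rnorm_cmul _ _) _; rewrite rnorm_cstar mulrC expr2 mulrA.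
  by rewrite ler_wpM2r ?rnorm_ge0 ?unorm_act.
rewrite -[rnorm b]ger0_norm ?rnorm_ge0 // -sqrtr_sqr -sqrtrM //.
rewrite -[rnorm (uact x b)]ger0_norm ?rnorm_ge0 // -sqrtr_sqr.
exact: ler_wsqrtr.
Qed.

Lemma unorm_star x : unorm (ustar x) = unorm x.
Proof.
have le y : unorm y <= unorm (ustar y).
  have := le_trans (unorm_sqr_le y) (unormM _ _).
  by have := unorm_ge0 y; have := unorm_ge0 (ustar y); nra.
by apply/eqP; rewrite eq_le le andbT -{2}(ustarK x) le.
Qed.

Lemma unorm_cstar x : unorm (ustar x * x) = unorm x ^+ 2.
Proof.
apply/eqP; rewrite eq_le unorm_sqr_le andbT.
by apply: le_trans (unormM _ _) _; rewrite unorm_star expr2.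
Qed.

End Unitization.

(** * Square roots and positivity *)

(** A Cauchy sequence with an explicit rate converges, and the rate passes to the limit; this rate
    is what later estimates use. *)
Lemma summable_cvg (K : numFieldType) (V : completeNormedModType K)
    (v : nat -> V) (e : nat -> K) :
  (forall n m, (n <= m)%N -> `|v m - v n| <= e n) ->
  (forall d, 0 < d -> exists n, e n < d) ->
  exists l, forall n, `|l - v n| <= e n.
Proof.
move=> hv he.
have /cauchy_cvgP/cvg_ex[l /cvgrPdist_le hl] : cauchy (v @ \oo).
  apply: cauchy_exP => d d0; have [N hN] := he d d0.
  exists (v N); exists N => // m /= Nm.
  by rewrite -ball_normE /= distrC; apply: le_lt_trans (hv _ _ Nm) hN.
exists l => n; apply/ler_addgt0Pr => d d0.
have [M _ hM] := hl d d0.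
have := hM (maxn M n) (leq_maxl _ _) => {}hM.
rewrite -(subrK (v (maxn M n)) l) -addrA addrC.
by apply: le_trans (ler_normD _ _) _; rewrite lerD // hv // leq_maxr.
Qed.

Section SqrtIteration.
Variable R : realType.

(* Majorant of the iteration for the square root, with limit 1. *)
Fixpoint sqrt_maj (n : nat) : R :=
  if n is n'.+1 then 2^-1 * (1 + sqrt_maj n' ^+ 2) else 0.

Lemma sqrt_maj_itv n : 0 <= sqrt_maj n <= 1.
Proof. by elim: n => [|n /andP[h0 h1]] /=; apply/andP; split; nra. Qed.

Lemma sqrt_majS n : sqrt_maj n <= sqrt_maj n.+1.
Proof. by have /andP[/=] := sqrt_maj_itv n; nra. Qed.

(** With s = 1 - r the recursion becomes s - s^2 / 2, increasing in s on [0, 1]; at s = 2 / (n + 2)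
    it is at most 2 / (n + 3), because (n + 1) (n + 3) <= (n + 2)^2. *)
Lemma sqrt_maj_rate n : (1 - sqrt_maj n) * (n%:R + 2) <= 2.
Proof.
elim: n => [|n IHn]; first by rewrite /= subr0 mul1r add0r.
have /andP[r0 r1] := sqrt_maj_itv n.
rewrite -natr1 /=; move: (sqrt_maj n) r0 r1 IHn => r r0 r1.
have : 0 <= n%:R :> R by []. move: (n%:R) => x x0 IH.
set s := 1 - r in IH; have -> : r = 1 - s by rewrite /s; ring.
have s0 : 0 <= s by rewrite /s; lra.
have s1 : s <= 1 by rewrite /s; lra.
have -> : 1 - 2^-1 * (1 + (1 - s) ^+ 2) = s - s ^+ 2 / 2 by field.
have h : s <= 2 / (x + 2) by rewrite ler_pdivlMr //; lra.
have : s - s ^+ 2 / 2 <= 2 / (x + 2) - (2 / (x + 2)) ^+ 2 / 2.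
  have : 2 / (x + 2) <= 1 by rewrite ler_pdivrMr //; lra.
  by move: (2 / (x + 2)) h => w; nra.
have -> : 2 / (x + 2) - (2 / (x + 2)) ^+ 2 / 2 = 2 * (x + 1) / (x + 2) ^+ 2.
  by field; lra.
move=> hs; have x3 : 0 <= x + 1 + 2 by lra.
apply: le_trans (ler_wpM2r x3 hs) _.
by rewrite mulrAC ler_pdivrMr ?exprn_gt0 //; nra.
Qed.

Lemma sqrt_maj_cvg (d : R) : 0 < d -> exists n, 1 - sqrt_maj n < d.
Proof.
move=> d0; have [n hn] : exists n : nat, 2 / d < n%:R.
  by exists (Num.bound (2 / d)); apply: archi_boundP; rewrite divr_ge0 // ltW.
exists n; have := sqrt_maj_rate n; rewrite ltr_pdivrMr // in hn.
have /andP[_ r1] := sqrt_maj_itv n.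
by move: (n%:R) hn (ler0n R n) => x; nra.
Qed.

(** Serves as the passage to the limit below. For t > 0 the case n = 0 forces c > 0, and then the
    right-hand side drops below t. *)
Lemma le0_sqrt_maj (t c : R) :
  (forall n, t <= c * (1 - sqrt_maj n)) -> t <= 0.
Proof.
move=> h; rewrite leNgt; apply/negP => t0.
have c0 : 0 < c by have := h 0%N; rewrite /= subr0 mulr1; apply: lt_le_trans.
have [n hn] := sqrt_maj_cvg (divr_gt0 t0 c0).
by have := h n; rewrite leNgt mulrC -ltr_pdivlMr // hn.
Qed.

End SqrtIteration.

(** * Completeness and positive elements of the unitization *)

Section UnitizationOrder.
Variables (R : realType) (A : cstarAlgType R).
Local Notation U := (unitization A).
Implicit Types (x y z k w : U) (t c : R).

(** Limits are taken in [A] and in the real and imaginary parts of the scalar; their errors 2 e, e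
    and e add up to 4 e. *)
Lemma unorm_complete (u : nat -> U) (e : nat -> R) :
  (forall n m, (n <= m)%N -> unorm (u m - u n) <= e n) ->
  (forall d, 0 < d -> exists n, e n < d) ->
  exists y, forall n, unorm (y - u n) <= 4 * e n.
Proof.
move=> hu he.
have [a ha] : exists a, forall n, rnorm (a - (u n).2) <= 2 * e n.
  have hu2 n m : (n <= m)%N -> `|(u m).2 - (u n).2| <= (2 * e n)%:C.
    move=> nm; rewrite rnormE lecR -unorm_emb.
    (* The component in [A] is the difference minus its scalar part, each of norm at most [e n]. *)
    have -> : uemb ((u m).2 - (u n).2) = (u m - u n) - (u m - u n).1 *: 1.
      congr (_, _) => /=; last by rewrite scaler0 subr0.
      by rewrite -[_ *: _]/(_ * _) mulr1 subrr.
    apply: le_trans (unormB _ _) _; rewrite unormZ unorm1 mulr1 mulr2n mulrDl mul1r.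
    by rewrite lerD ?hu //; apply: le_trans (unorm_scal _) (hu _ _ nm).
  have he2 (d : R[i]) : 0 < d -> exists n, (2 * e n)%:C < d.
    case: d => d d'; rewrite ltcE /= => /andP[/eqP -> d0].
    have [n hn] := he (d / 2) (divr_gt0 d0 (ltr0n _ 2)).
    by exists n; rewrite ltcE /= eqxx /=; lra.
  have [a ha] := summable_cvg hu2 he2.
  by exists a => n; rewrite -lecR -rnormE.
have hs n m : (n <= m)%N -> rnorm ((u m).1 - (u n).1) <= e n.
  by move=> nm; apply: le_trans (unorm_scal _) (hu _ _ nm).
have [p hp] : exists p : R, forall n, `|p - complex.Re (u n).1| <= e n.
  apply: summable_cvg he => n m /hs; apply: le_trans; rewrite -raddfB /=.
  rewrite ler_norml rnorm_Re andbT lerNl -raddfN /=.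
  by apply: le_trans (rnorm_Re _) _; rewrite rnormN.
have [q hq] : exists q : R, forall n, `|q - complex.Im (u n).1| <= e n.
  apply: summable_cvg he => n m /hs; apply: le_trans; rewrite -raddfB /=.
  move: (_ - _) => l; rewrite /rnorm normc_def /=.
  by rewrite -sqrtr_sqr ler_wsqrtr // lerDr sqr_ge0.
exists (p +i* q, a) => n.
have -> : (p +i* q, a) - u n =
    (p - complex.Re (u n).1)%:C *: (1 : U) +
    ('i%C * (q - complex.Im (u n).1)%:C) *: (1 : U) + uemb (a - (u n).2).
  case: (u n) => -[r s] b; congr (_, _) => /=; last first.
    by rewrite !scaler0 !add0r.
  rewrite -[_ *: _]/(_ * _) -[X in _ + X + _]/(_ * _) !mulr1.
  by apply/eqP; rewrite eq_complex /=; apply/andP; split; apply/eqP; ring.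
apply: le_trans (unormD _ _) _; apply: le_trans (lerD (unormD _ _) (lexx _)) _.
rewrite unorm_emb !unormZ unorm1 rnormM !rnormC.
have -> : rnorm ('i%C : R[i]) = 1.
  by rewrite /rnorm normc_def /= expr0n expr1n /= add0r sqrtr1.
by have := hp n; have := hq n; have := ha n; lra.
Qed.

Lemma unorm_subr_sqr x y a b : unorm x <= a -> unorm y <= b ->
  unorm (x ^+ 2 - y ^+ 2) <= (a + b) * unorm (x - y).
Proof.
move=> xa yb; have -> : x ^+ 2 - y ^+ 2 = x * (x - y) + (x - y) * y.
  by rewrite mulrBr mulrBl addrA subrK.
apply: le_trans (unormD _ _) _; rewrite [leRHS]mulrDl lerD //.
  by apply: le_trans (unormM _ _) _; rewrite ler_wpM2r ?unorm_ge0.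
by apply: le_trans (unormM _ _) _; rewrite mulrC ler_wpM2r ?unorm_ge0.
Qed.

Lemma unorm_sa_sqr x : ustar x = x -> unorm (x ^+ 2) = unorm x ^+ 2.
Proof. by move=> xs; rewrite expr2 -{1}xs unorm_cstar. Qed.

Lemma unorm_le0 x : unorm x <= 0 -> x = 0.
Proof. by move=> h; apply: unorm0_eq0; apply/eqP; rewrite eq_le h unorm_ge0. Qed.

Lemma half_scale2 x : (2^-1)%:C *: x *+ 2 = x.
Proof.
rewrite -scaler_nat scalerA -[2%:R]/((1 + 1) : R[i]).
have -> : (1 + 1 : R[i]) * (2^-1)%:C = 1.
  have -> : (1 + 1 : R[i]) = 2%:R%:C by rewrite rmorph_nat.
  by rewrite -rmorphM mulfV // pnatr_eq0.
by rewrite scale1r.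
Qed.

(* The solution of 2 y = x + y^2 is the limit of u' = (x + u^2) / 2, whose
   increments are dominated by those of the same iteration at x = 1. *)
Lemma sqrt_one_sub x : ustar x = x -> unorm x <= 1 ->
  exists y, [/\ ustar y = y, (1 - y) ^+ 2 = 1 - x, unorm y <= 1 &
    forall z, z * x = x * z -> z * y = y * z].
Proof.
move=> xs x1.
pose u := fix u n : U :=
  if n is n'.+1 then (2^-1)%:C *: (x + u n' ^+ 2) else 0.
have uS n : u n.+1 = (2^-1)%:C *: (x + u n ^+ 2) by [].
have h0 : 0 <= 2^-1 :> R by rewrite invr_ge0.
have ule n : unorm (u n) <= sqrt_maj R n.
  elim: n => [|n IHn]; first by rewrite unorm0.
  rewrite uS unormZr ger0_norm //= ler_wpM2l //.
  apply: le_trans (unormD _ _) _; rewrite lerD // expr2.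
  by apply: le_trans (unormM _ _) _; rewrite expr2 ler_pM ?unorm_ge0.
have uinc n : unorm (u n.+1 - u n) <= sqrt_maj R n.+1 - sqrt_maj R n.
  elim: n => [|n IHn].
    rewrite uS /= expr0n addr0 !subr0 unormZr ger0_norm // expr0n addr0 mulr1.
    by rewrite ler_piMr.
  rewrite [u n.+2]uS {2}uS -scalerBr opprD addrACA subrr add0r unormZr ger0_norm //.
  have := unorm_subr_sqr (ule n.+1) (ule n).
  have /andP[r0 _] := sqrt_maj_itv R n.
  have /andP[s0 _] := sqrt_maj_itv R n.+1.
  have -> : sqrt_maj R n.+2 - sqrt_maj R n.+1 =
    2^-1 * ((sqrt_maj R n.+1 + sqrt_maj R n) * (sqrt_maj R n.+1 - sqrt_maj R n)).
    transitivity (2^-1 * (1 + sqrt_maj R n.+1 ^+ 2) - 2^-1 * (1 + sqrt_maj R n ^+ 2)).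
      by [].
    by move: (sqrt_maj R n.+1) (sqrt_maj R n) => p q; ring.
  move=> h; rewrite ler_wpM2l //; apply: le_trans h _.
  by rewrite ler_wpM2l // addr_ge0.
have umono n m : (n <= m)%N -> unorm (u m - u n) <= 1 - sqrt_maj R n.
  move=> nm; apply: (@le_trans _ _ (sqrt_maj R m - sqrt_maj R n)); last first.
    by rewrite lerD2r; case/andP: (sqrt_maj_itv R m).
  rewrite -(subnK nm); elim: (m - n)%N => [|p IHp].
    by rewrite add0n !subrr unorm0.
  rewrite addSn -(subrK (u (p + n)%N) (u _.+1)) -addrA.
  apply: le_trans (unormD _ _) _.
  by apply: le_trans (lerD (uinc _) IHp) _; rewrite addrA subrK.
have [y hy] := unorm_complete umono (@sqrt_maj_cvg R).
have y1 : unorm y <= 1.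
  rewrite -subr_le0; apply: (@le0_sqrt_maj R _ 4) => n.
  have := unormD (y - u n) (u n); rewrite subrK.
  have := hy n; have := ule n; have /andP[_] := sqrt_maj_itv R n; lra.
have us n : ustar (u n) = u n.
  elim: n => [|n IHn]; first exact: ustar0.
  by rewrite uS ustarZr ustarD xs ustarM IHn.
(* Limit of the recursion: the errors in 2 y and in y^2 are each at most 8 (1 - [sqrt_maj R n]),
   hence the constant 16. *)
have yeq : y *+ 2 = x + y ^+ 2.
  apply/eqP; rewrite -subr_eq0; apply/eqP; apply: unorm_le0.
  apply: (@le0_sqrt_maj R _ 16) => n.
  have -> : y *+ 2 - (x + y ^+ 2) = (y - u n.+1) *+ 2 - (y ^+ 2 - u n ^+ 2).
    rewrite mulrnBl uS half_scale2 -[RHS]addrA -opprD; congr (_ - _).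
    by rewrite addrAC -addrA addrC subrK addrC.
  apply: le_trans (unormB _ _) _; rewrite mulr2n.
  apply: le_trans (lerD (unormD _ _) (unorm_subr_sqr y1 (ule n))) _.
  have := hy n; have := hy n.+1; have := sqrt_majS R n.
  have /andP[] := sqrt_maj_itv R n; have := unorm_ge0 (y - u n).
  by move: (unorm (y - u n)) (sqrt_maj R n) => p q; nra.
exists y; split=> //.
- apply/eqP; rewrite -subr_eq0; apply/eqP; apply: unorm_le0.
  apply: (@le0_sqrt_maj R _ 8) => n.
  have -> : ustar y - y = ustar (y - u n) - (y - u n).
    by rewrite ustarB us opprB addrA subrK.
  apply: le_trans (unormB _ _) _; rewrite unorm_star.
  by have := hy n; lra.
- rewrite -sqrrN opprB sqrrB1 yeq opprD addrCA subrr addr0 addrC.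
  by [].
- move=> z zx; apply/eqP; rewrite -subr_eq0; apply/eqP; apply: unorm_le0.
  have zu n : z * u n = u n * z.
    elim: n => [|n IHn]; first by rewrite mulr0 mul0r.
    rewrite uS -scalerAr -scalerAl mulrDr mulrDl zx expr2 mulrA IHn.
    by rewrite -mulrA IHn mulrA.
  apply: (@le0_sqrt_maj R _ (8 * unorm z)) => n.
  have -> : z * y - y * z = z * (y - u n) - (y - u n) * z.
    by rewrite mulrBr mulrBl zu opprB addrA subrK.
  apply: le_trans (unormB _ _) _.
  apply: le_trans (lerD (unormM _ _) (unormM _ _)) _.
  have := hy n; have := unorm_ge0 z; move: (unorm (y - u n)) => p; nra.
Qed.

Local Notation "t %:U" := (t%:C *: (1 : U)) (at level 1, format "t %:U").

Lemma realZ_mulU t x : t%:U * x = t%:C *: x.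
Proof. by rewrite -scalerAl mul1r. Qed.

Lemma realZ_mulUr t x : x * t%:U = t%:C *: x.
Proof. by rewrite -scalerAr mulr1. Qed.

Lemma realU_comm t x : t%:U * x = x * t%:U.
Proof. by rewrite realZ_mulU realZ_mulUr. Qed.

Lemma realUD t c : (t + c)%:U = t%:U + c%:U.
Proof. by rewrite rmorphD scalerDl. Qed.

Lemma realUB t c : (t - c)%:U = t%:U - c%:U.
Proof. by rewrite rmorphB scalerBl. Qed.

Lemma realZA t c x : t%:C *: (c%:C *: x) = (t * c)%:C *: x.
Proof. by rewrite scalerA rmorphM. Qed.

Lemma realZ1 x : (1%:C : R[i]) *: x = x.
Proof. by rewrite scale1r. Qed.

Lemma sa_realU t : ustar t%:U = t%:U.
Proof. by rewrite ustarZr ustar1. Qed.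

Lemma unorm_realU t : unorm t%:U = `|t|.
Proof. by rewrite unormZr unorm1 mulr1. Qed.

Lemma sa_mul x y : ustar x = x -> ustar y = y -> x * y = y * x ->
  ustar (x * y) = x * y.
Proof. by move=> xs ys xy; rewrite ustarM xs ys. Qed.

Lemma sqrr_comm x y : x * y = y * x -> (x * y) ^+ 2 = x ^+ 2 * y ^+ 2.
Proof. exact: exprMn_comm. Qed.

Lemma comm_sub x y z : z * x = x * z -> z * y = y * z -> z * (x - y) = (x - y) * z.
Proof. by move=> h1 h2; rewrite mulrBr mulrBl h1 h2. Qed.

Lemma comm_add x y z : z * x = x * z -> z * y = y * z -> z * (x + y) = (x + y) * z.
Proof. by move=> h1 h2; rewrite mulrDr mulrDl h1 h2. Qed.

(* k + i w is normal and (k + i w)^* (k + i w) = k^2 + w^2. *)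
Lemma unorm_sqr_le_sqrD k w :
  ustar k = k -> ustar w = w -> k * w = w * k ->
  unorm k ^+ 2 <= unorm (k ^+ 2 + w ^+ 2).
Proof.
move=> ks ws kw; pose u := k + 'i%R *: w.
have us : ustar u = k - 'i%R *: w.
  by rewrite ustarD ustarZ ks ws conjCi scaleNr.
have -> : k ^+ 2 + w ^+ 2 = ustar u * u.
  rewrite us /u mulrDr !mulrBl -!scalerAl -!scalerAr scalerA -['i%R * _]expr2 sqrCi.
  by rewrite scaleN1r opprK -!expr2 kw addrA subrK.
rewrite unorm_cstar ler_sqr ?nnegrE ?unorm_ge0 //.
have : k *+ 2 = u + ustar u by rewrite us /u addrACA subrr addr0.
rewrite -scaler_nat -[2%:R](rmorph_nat (real_complex R)) => h.
have := unormD u (ustar u); rewrite -h unormZr unorm_star ger0_norm //; lra.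
Qed.

(* For self-adjoint x, the bound ||t - x|| <= t says that the spectrum of x lies
   in [0, 2 t]; in this form sums are positive by the triangle inequality. *)
Definition upos x := ustar x = x /\ exists t, unorm (t%:U - x) <= t.

Lemma upos_sa x : upos x -> ustar x = x.
Proof. by case. Qed.

Lemma uposD x y : upos x -> upos y -> upos (x + y).
Proof.
move=> [xs [t ht]] [ys [c hc]]; split; first by rewrite ustarD xs ys.
exists (t + c); rewrite realUD opprD addrACA.
by apply: le_trans (unormD _ _) _; rewrite lerD.
Qed.

Lemma uposZ c x : 0 <= c -> upos x -> upos (c%:C *: x).
Proof.
move=> c0 [xs [t ht]]; split; first by rewrite ustarZr xs.
exists (c * t); rewrite -realZA -scalerBr unormZr ger0_norm //.
by rewrite ler_wpM2l.
Qed.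

Lemma upos_sub_unorm x t : ustar x = x -> unorm x <= t -> upos (t%:U - x).
Proof.
move=> xs xt; split; first by rewrite ustarB xs sa_realU.
by exists t; rewrite opprB addrC subrK.
Qed.

Lemma upos_realU t : 0 <= t -> upos t%:U.
Proof.
move=> t0; split; first exact: sa_realU.
by exists t; rewrite subrr unorm0.
Qed.

Lemma upos_realU_ge0 t : upos t%:U -> 0 <= t.
Proof.
case=> _ [c]; rewrite -realUB unorm_realU => h.
by have := ler_norm (c - t); lra.
Qed.

(** For t > 0, g = 1 - x / t has norm at most 1, and [sqrt_one_sub] gives (1 - y)^2 = x / t. The
    root sqrt(t) (1 - y) is positive with witness sqrt(t), because ||y|| <= 1. *)
Lemma upos_root x : upos x ->
  exists k, [/\ ustar k = k, upos k, k ^+ 2 = x &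
    forall z, z * x = x * z -> z * k = k * z].
Proof.
move=> [xs [t ht]].
have t0 : 0 <= t := le_trans (unorm_ge0 _) ht.
have [t_eq0|t_neq0] := eqVneq t 0.
  have x0 : x = 0.
    apply: unorm_le0; rewrite -unormN.
    by move: ht; rewrite t_eq0 scale0r add0r.
  exists 0; rewrite x0; split=> //.
  - exact: ustar0.
  - by have := upos_realU (lexx 0); rewrite scale0r.
  - by rewrite expr0n.
have t_gt0 : 0 < t by rewrite lt_def t_neq0.
pose g := (t^-1)%:C *: (t%:U - x).
have gs : ustar g = g by rewrite /g ustarZr ustarB sa_realU xs.
have g1 : unorm g <= 1.
  rewrite /g unormZr ger0_norm ?invr_ge0 // mulrC.
  by rewrite ler_pdivrMr // mul1r.
have [y [ys ysq y1 yc]] := sqrt_one_sub gs g1.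
have s0 := sqrtr_ge0 t.
have ks : ustar ((Num.sqrt t)%:C *: (1 - y)) = (Num.sqrt t)%:C *: (1 - y).
  by rewrite ustarZr ustarB ustar1 ys.
exists ((Num.sqrt t)%:C *: (1 - y)); split=> //.
- split=> //; exists (Num.sqrt t).
  rewrite -scalerBr opprB addrC subrK unormZr ger0_norm //.
  by rewrite ler_piMr.
- rewrite exprZn ysq -rmorphXn /= sqr_sqrtr // scalerBr.
  have -> : t%:C *: g = t%:U - x by rewrite realZA mulfV // realZ1.
  by rewrite opprB addrC subrK.
- move=> z zx; have zg : z * g = g * z.
    rewrite /g -scalerAr -scalerAl; congr (_ *: _).
    by apply: comm_sub => //; rewrite realU_comm.
  rewrite -scalerAr -scalerAl; congr (_ *: _).
  by apply: comm_sub; rewrite ?mulr1 ?mul1r // yc.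
Qed.

(** Rescale to k'^2 = k^2 / t and let m = 1 - y be a root of 1 - k'^2. Since m and k' commute and
    m^2 + k'^2 = 1, [unorm_sqr_le_sqrD] gives ||1 - k'^2|| = ||m||^2 <= 1. *)
Lemma unorm_sub_sqr k t :
  ustar k = k -> unorm k ^+ 2 <= t -> unorm (t%:U - k ^+ 2) <= t.
Proof.
move=> ks kt; have t0 : 0 <= t by apply: le_trans kt; rewrite exprn_ge0 ?unorm_ge0.
have [t_eq0|t_neq0] := eqVneq t 0.
  have -> : k = 0.
    apply: unorm_le0; move: kt; rewrite t_eq0; have := unorm_ge0 k; nra.
  by rewrite t_eq0 scale0r expr0n subr0 unorm0.
have t_gt0 : 0 < t by rewrite lt_def t_neq0.
have ti0 : 0 <= t^-1 by rewrite invr_ge0.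
pose g := (t^-1)%:C *: k ^+ 2.
have gs : ustar g = g by rewrite /g ustarZr expr2 ustarM ks.
have g1 : unorm g <= 1.
  rewrite unormZr ger0_norm // unorm_sa_sqr // mulrC.
  by rewrite ler_pdivrMr // mul1r.
have [y [ys ysq y1 yc]] := sqrt_one_sub gs g1.
pose s := Num.sqrt t^-1.
have s2 : s ^+ 2 = t^-1 by rewrite sqr_sqrtr.
pose k' := s%:C *: k.
have k'2 : k' ^+ 2 = g by rewrite exprZn -rmorphXn /= s2.
have k's : ustar k' = k' by rewrite ustarZr ks.
have ms : ustar (1 - y) = 1 - y by rewrite ustarB ustar1 ys.
have comm : (1 - y) * k' = k' * (1 - y).
  symmetry; apply: comm_sub; rewrite ?mulr1 ?mul1r //.
  by apply: yc; rewrite -k'2 -exprS -exprSr.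
have := unorm_sqr_le_sqrD ms k's comm.
rewrite ysq k'2 subrK unorm1 -unorm_sa_sqr // ysq => h.
have -> : t%:U - k ^+ 2 = t%:C *: (1 - g).
  by rewrite scalerBr realZA mulfV // realZ1.
by rewrite unormZr ger0_norm // ler_piMr.
Qed.

Lemma upos_sqr k : ustar k = k -> upos (k ^+ 2).
Proof.
move=> ks; split; first by rewrite expr2 ustarM ks.
by exists (unorm k ^+ 2); apply: unorm_sub_sqr.
Qed.

(** Positivity only provides some witness; writing x as a square shows that any bound of the norm is
    one. *)
Lemma unorm_realU_sub_le x t : upos x -> unorm x <= t -> unorm (t%:U - x) <= t.
Proof.
move=> /upos_root[k [ks _ <- _]]; rewrite unorm_sa_sqr //.
exact: unorm_sub_sqr.
Qed.

(** The roots of c - x and c + x commute, so their product is self-adjoint with square c^2 - x^2.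
    This is positive, hence some w^2, and x^2 + w^2 = c^2 bounds ||x||. *)
Lemma unorm_le_realU c x : 0 <= c -> upos (c%:U - x) -> upos (c%:U + x) ->
  ustar x = x -> unorm x <= c.
Proof.
move=> c0 /upos_root[k [ks _ k2 kc]] /upos_root[m [ms _ m2 mc]] xs.
have xc : x * c%:U = c%:U * x by rewrite realU_comm.
have km : k * m = m * k.
  apply: mc; symmetry; apply: kc.
  by apply: comm_sub; symmetry; apply: comm_add; rewrite // realU_comm.
have := upos_sqr (sa_mul ks ms km); rewrite sqrr_comm // k2 m2.
have -> : (c%:U - x) * (c%:U + x) = (c ^+ 2)%:U - x ^+ 2.
  rewrite mulrDr !mulrBl xc addrA subrK; congr (_ - _).
  by rewrite realZ_mulU realZA expr2.
move=> /upos_root[w [ws _ w2 wc]].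
have xw : x * w = w * x.
  by apply: wc; apply: comm_sub; rewrite ?realU_comm // -exprS -exprSr.
have := unorm_sqr_le_sqrD xs ws xw; rewrite w2 addrC subrK unorm_realU.
rewrite ger0_norm ?exprn_ge0 // ler_sqr ?nnegrE ?unorm_ge0 //.
Qed.

(** Recentre at c / 2: the hypotheses place x - c / 2 between - c / 2 and c / 2. *)
Lemma upos_unorm_le c x : upos x -> upos (c%:U - x) -> unorm x <= c.
Proof.
move=> xp cx; have cp := uposD cx xp; rewrite subrK in cp.
have c0 := upos_realU_ge0 cp.
have c2 : (c / 2)%:U + (c / 2)%:U = c%:U by rewrite -realUD -splitr.
have h : unorm (x - (c / 2)%:U) <= c / 2.
  apply: unorm_le_realU; first by rewrite divr_ge0.
  - by rewrite opprB addrA c2.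
  - by rewrite addrC subrK.
  - by rewrite ustarB sa_realU (upos_sa xp).
rewrite -(subrK (c / 2)%:U x); apply: le_trans (unormD _ _) _.
by rewrite unorm_realU ger0_norm ?divr_ge0 //; lra.
Qed.

(** With t = ||x + c||, the element (t - c) - x is positive, so ||x|| <= t - c. *)
Lemma unorm_add_realU x c : 0 <= c -> upos x ->
  unorm x + c <= unorm (x + c%:U).
Proof.
move=> c0 xp; rewrite -lerBrDr; apply: upos_unorm_le => //.
rewrite realUB -addrA -opprD [_ + x]addrC; apply: upos_sub_unorm => //.
by rewrite ustarD sa_realU (upos_sa xp).
Qed.

Lemma upos_sa_add_sqr x : upos (ustar x * x + x * ustar x).
Proof.
pose a := x + ustar x; pose b := 'i%R *: (x - ustar x).
have as_ : ustar a = a by rewrite ustarD ustarK addrC.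
have bs : ustar b = b.
  by rewrite ustarZ conjCi ustarB ustarK scaleNr -scalerN opprB.
have e : a ^+ 2 + b ^+ 2 = (ustar x * x + x * ustar x) *+ 2.
  have -> : b ^+ 2 = - (x - ustar x) ^+ 2 by rewrite exprZn sqrCi scaleN1r.
  have -> : (x - ustar x) ^+ 2 =
      x * x - ustar x * x - (x * ustar x - ustar x * ustar x).
    by rewrite expr2 mulrBr !mulrBl.
  rewrite expr2 /a mulrDr !mulrDl.
  rewrite !opprB mulr2n [LHS](AC ((2*2)*(2*2)) ((2*3)*(7*5)*(1*8)*(4*6))).
  by rewrite /= !subrr !addr0.
have -> : ustar x * x + x * ustar x = (2^-1)%:C *: (a ^+ 2 + b ^+ 2).
  by rewrite e -scalerMnr half_scale2.
by apply: uposZ; rewrite ?invr_ge0 //; apply: uposD; apply: upos_sqr.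
Qed.

(* Let h = x^* x, r = |h|, v = r - h and c = x v. Then - c^* c = g is a square,
   so c c^* is positive by the previous lemma, and with n = ||g|| = ||c c^*||
   the identity (n + g) g = - c^* (n - c c^* ) c bounds ||n g + g^2|| by n^2.
   As g is positive this forces g = 0, hence c = 0, v = 0 and h = r. *)
Lemma upos_cstar x : upos (ustar x * x).
Proof.
pose h := ustar x * x.
have hs : ustar h = h by rewrite ustarM ustarK.
have [r [rs rp r2 rc]] := upos_root (upos_sqr hs).
have hr : h * r = r * h by apply: rc; rewrite -exprS -exprSr.
have [k [ks _ k2 kc]] := upos_root rp.
have hk : h * k = k * h by apply: kc.
have rk : r * k = k * r by apply: kc.
pose v := r - h; pose c := x * v.
have vs : ustar v = v by rewrite ustarB rs hs.
have kv : k * v = v * k by apply: comm_sub.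
pose g := (k * v) ^+ 2.
have gp : upos g by apply/upos_sqr/sa_mul.
(* Uses r^2 = h^2 and the commutation of h with r. *)
have hv : h * v = - (r * v) by rewrite !mulrBr hr -!expr2 r2 opprB.
have rv : r * v = v * r by symmetry; rewrite mulrBl mulrBr hr.
have cc : ustar c * c = - g.
  rewrite ustarM vs -mulrA [ustar x * _]mulrA -/h hv mulrN; congr (- _).
  by rewrite /g sqrr_comm // k2 mulrA -rv -mulrA expr2.
have ccp : upos (c * ustar c).
  have := uposD (upos_sa_add_sqr c) gp; rewrite cc.
  by rewrite addrAC addNr add0r.
pose n := unorm g.
have n0 : 0 <= n := unorm_ge0 g.
have cn : unorm c ^+ 2 = n by rewrite -unorm_cstar cc unormN.
have ccn : unorm (c * ustar c) = n.
  by rewrite -{1}[c]ustarK unorm_cstar unorm_star.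
have e1 : unorm (n%:C *: g + g ^+ 2) <= n ^+ 2.
  have -> : n%:C *: g + g ^+ 2 = - (ustar c * ((n%:U - c * ustar c) * c)).
    rewrite mulrBl mulrBr realZ_mulU -scalerAr cc -mulrA cc !mulrN mulrA cc.
    by rewrite mulNr !scalerN opprB opprK -expr2 addrC opprK.
  rewrite unormN; apply: le_trans (unormM _ _) _.
  apply: le_trans (ler_wpM2l (unorm_ge0 _) (unormM _ _)) _.
  have := unorm_realU_sub_le ccp (lexx _); rewrite ccn.
  rewrite unorm_star => hh; rewrite mulrCA -expr2 cn expr2.
  exact: ler_wpM2r.
(* Completing the square: ||m||^2 <= n^2 + n^2 / 4, whereas positivity of g gives ||m|| >= 3 n / 2;
   together they force n = 0. *)
pose m := g + (n / 2)%:U.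
have n20 : 0 <= n / 2 by rewrite divr_ge0.
have ms : ustar m = m by rewrite ustarD sa_realU (upos_sa gp).
have m2 : m ^+ 2 = (n%:C *: g + g ^+ 2) + ((n / 2) ^+ 2)%:U.
  rewrite /m expr2 mulrDr !mulrDl !realZ_mulU realZ_mulUr realZA -expr2.
  rewrite -addrA [_ *: g + (_ + _)]addrA -scalerDl -rmorphD /= -splitr.
  by rewrite addrA [g ^+ 2 + _]addrC -expr2.
have h1 : unorm m ^+ 2 <= n ^+ 2 + (n / 2) ^+ 2.
  rewrite -unorm_sa_sqr // m2; apply: le_trans (unormD _ _) _.
  by rewrite unorm_realU ger0_norm ?exprn_ge0 // lerD2r.
have h2 := unorm_add_realU n20 gp.
have g0 : g = 0.
  apply: unorm_le0; rewrite -/n in h2 *; rewrite -/m in h2.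
  by have := unorm_ge0 m; move: (unorm m) h1 h2 => w; nra.
have c0 : c = 0.
  apply: unorm_le0; move: cn; rewrite /n g0 unorm0.
  by have := unorm_ge0 c; nra.
have hv0 : h * v = 0 by rewrite -mulrA -/c c0 mulr0.
(* Here v^2 = r v - h v, and both terms vanish because h v = - r v = 0. *)
have v0 : v = 0.
  apply: unorm_le0; have : unorm v ^+ 2 = 0.
    rewrite -unorm_sa_sqr // expr2 {1}/v mulrBl hv0 subr0.
    by move: hv; rewrite hv0 => /esym/eqP; rewrite oppr_eq0 => /eqP ->; rewrite unorm0.
  by have := unorm_ge0 v; nra.
by move/eqP: v0; rewrite subr_eq0 -/h => /eqP <-.
Qed.

(** If x = k^2 with k self-adjoint, the element is (k y)^* (k y). *)
Lemma upos_conj x y : upos x -> upos (ustar y * x * y).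
Proof.
move=> /upos_root[k [ks _ <- _]].
by rewrite expr2 mulrA -mulrA -{1}ks -ustarM; apply: upos_cstar.
Qed.

End UnitizationOrder.

(** * Norm-attaining states *)

Section HahnBanach.
Variables (R : realType) (V : lmodType R).
Implicit Types (p q : V -> R) (x y a : V).

(** Homogeneity is stated as an inequality, easier to check for infima; [sublinearZ] recovers
    equality. *)
Definition sublinear q :=
  (forall x y, q (x + y) <= q x + q y) /\
  (forall t x, 0 <= t -> q (t *: x) <= t * q x).

Section SublinearTheory.
Variable q : V -> R.
Hypothesis qs : sublinear q.

Lemma sublinear_ge0 : 0 <= q 0.
Proof. by have [qD _] := qs; have := qD 0 0; rewrite addr0; lra. Qed.

Lemma sublinear0 : q 0 = 0.
Proof.
apply/eqP; rewrite eq_le sublinear_ge0 andbT.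
by have := qs.2 0 0 (lexx 0); rewrite scale0r mul0r.
Qed.

Lemma sublinearZ t x : 0 <= t -> q (t *: x) = t * q x.
Proof.
move=> t0; have [->|t_neq0] := eqVneq t 0.
  by rewrite scale0r mul0r sublinear0.
have t_gt0 : 0 < t by rewrite lt_def t_neq0.
apply/eqP; rewrite eq_le qs.2 //= mulrC -ler_pdivlMr // mulrC.
rewrite -{1}[x]scale1r -(mulVf t_neq0) -scalerA qs.2 // invr_ge0.
exact: t0.
Qed.

Lemma sublinearN x : - q (- x) <= q x.
Proof. by have := qs.1 x (- x); rewrite subrr sublinear0; lra. Qed.

(** [q] lowered so that its value at [- a] is at most [- q a]; the infimum is finite, being bounded
    below by [- q (- x)]. *)
Definition sublinear_dir a x : R :=
  inf [set q (x + t *: a) - t * q a | t in [set t : R | 0 <= t]].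

Lemma sublinear_dir_has_inf a x :
  has_inf [set q (x + t *: a) - t * q a | t in [set t : R | 0 <= t]].
Proof.
split; first by exists (q (x + 0 *: a) - 0 * q a); exists 0 => //=.
exists (- q (- x)) => _ [t /= t0 <-].
have := qs.1 (x + t *: a) (- x).
by rewrite addrAC subrr add0r sublinearZ //; lra.
Qed.

Lemma sublinear_dir_le a x t : 0 <= t ->
  sublinear_dir a x <= q (x + t *: a) - t * q a.
Proof.
move=> t0; apply: ge_inf; first by case: (sublinear_dir_has_inf a x).
by exists t.
Qed.

Lemma sublinear_dir_ge a x c :
  (forall t, 0 <= t -> c <= q (x + t *: a) - t * q a) -> c <= sublinear_dir a x.
Proof.
move=> h; apply: lb_le_inf; first by case: (sublinear_dir_has_inf a x).
by move=> _ [t /= t0 <-]; exact: h.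
Qed.

Lemma sublinear_dir_sublinear a : sublinear (sublinear_dir a).
Proof.
split=> [x y|c x c0].
  rewrite -lerBlDr; apply: sublinear_dir_ge => t t0.
  rewrite lerBlDr -lerBlDl; apply: sublinear_dir_ge => s s0.
  rewrite lerBlDl.
  apply: le_trans (sublinear_dir_le a (x + y) (addr_ge0 t0 s0)) _.
  rewrite scalerDl addrACA.
  by have := qs.1 (x + t *: a) (y + s *: a); lra.
have [->|c_neq0] := eqVneq c 0.
  rewrite scale0r mul0r; apply: le_trans (sublinear_dir_le a 0 (lexx 0)) _.
  by rewrite scale0r addr0 sublinear0 mul0r subr0.
have c_gt0 : 0 < c by rewrite lt_def c_neq0.
rewrite mulrC -ler_pdivrMr //; apply: sublinear_dir_ge => t t0.
rewrite ler_pdivrMr //.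
apply: le_trans (sublinear_dir_le a (c *: x) (mulr_ge0 c0 t0)) _.
by rewrite -scalerA -scalerDr sublinearZ //; lra.
Qed.

Lemma sublinear_dir_le_id a x : sublinear_dir a x <= q x.
Proof.
apply: le_trans (sublinear_dir_le a x (lexx 0)) _.
by rewrite scale0r addr0 mul0r subr0.
Qed.

Lemma sublinear_dirN a : sublinear_dir a (- a) <= - q a.
Proof.
apply: le_trans (sublinear_dir_le a (- a) ler01) _.
by rewrite scale1r addNr sublinear0 mul1r add0r.
Qed.

End SublinearTheory.

(** Zorn's lemma for the reversed pointwise order. A nonempty chain is bounded by its pointwise
    infimum, finite since every member is at least [- p (- x)] at [x]; the empty chain is bounded by
    [p]. *)
Lemma sublinear_minimal p : sublinear p -> exists q,
  [/\ sublinear q, forall x, q x <= p x &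
    forall q', sublinear q' -> (forall x, q' x <= q x) -> q' = q].
Proof.
move=> ps.
pose T := {q : V -> R | sublinear q /\ forall x, q x <= p x}.
pose ge (s t : T) : bool := `[< forall x, sval t x <= sval s x >].
have [|||C totC|[q [qs qp]] qmin] := @Zorn T ge.
- by move=> s; apply/asboolP.
- move=> r s t /asboolP rs /asboolP st; apply/asboolP => x.
  exact: le_trans (st x) (rs x).
- move=> [s sp] [t tp] /asboolP /= st /asboolP /= ts; apply: eq_exist.
  by apply/funext => x; apply/eqP; rewrite eq_le ts st.
- have [[s0 Cs0]|C0] := pselect (exists s, C s); last first.
    by exists (exist _ p (conj ps (fun x => lexx _))) => s Cs; case: C0; exists s.
  pose m x := inf [set sval s x | s in C].
  have hasm x : has_inf [set sval s x | s in C].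
    split; first by exists (sval s0 x); exists s0.
    exists (- p (- x)) => _ [s Cs <-].
    case: s Cs => s [ss sp] Cs /=; apply: le_trans (sublinearN ss x).
    by rewrite lerN2.
  have m_le s x : C s -> m x <= sval s x.
    by move=> Cs; apply: ge_inf; [case: (hasm x) | exists s].
  have m_ge x c : (forall s, C s -> c <= sval s x) -> c <= m x.
    move=> h; apply: lb_le_inf; first by case: (hasm x).
    by move=> _ [s Cs <-]; exact: h.
  have ms : sublinear m.
    split=> [x y|c x c0].
      rewrite -lerBlDr; apply: (m_ge) => s Cs.
      rewrite lerBlDr -lerBlDl; apply: (m_ge) => t Ct.
      rewrite lerBlDl; have [ss _] := svalP s; have [ts _] := svalP t.
      (* The smaller of the two chain members bounds the infimum at [x + y] and lies below both. *)
      case: (totC s t Cs Ct) => /asboolP st.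
        apply: le_trans (m_le t _ Ct) _.
        by have := ts.1 x y; have := st x; lra.
      apply: le_trans (m_le s _ Cs) _.
      by have := ss.1 x y; have := st y; lra.
    have [->|c_neq0] := eqVneq c 0.
      rewrite scale0r mul0r; apply: le_trans (m_le s0 _ Cs0) _.
      by have [ss _] := svalP s0; rewrite sublinear0.
    have c_gt0 : 0 < c by rewrite lt_def c_neq0.
    rewrite mulrC -ler_pdivrMr //; apply: (m_ge) => s Cs.
    rewrite ler_pdivrMr //; apply: le_trans (m_le s _ Cs) _.
    by have [ss _] := svalP s; rewrite mulrC ss.2.
  have mp x : m x <= p x.
    by apply: le_trans (m_le s0 _ Cs0) _; case: (svalP s0).
  by exists (exist _ m (conj ms mp)) => s Cs; apply/asboolP => x; exact: m_le.
exists q; split=> // q' q's q'q.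
have q'p x : q' x <= p x := le_trans (q'q x) (qp x).
by apply: (congr1 sval (qmin (exist _ q' (conj q's q'p)) _)); apply/asboolP.
Qed.

(* A minimal sublinear functional q is linear, because q'(x) =
   inf_(t >= 0) (q (x + t a) - t q a) is sublinear, q' <= q and q'(-a) <= - q a.
   Starting from such a modification of p gives the value p a at a. *)
Lemma hahn_banach_dominated p a : sublinear p ->
  exists f : {scalar V}, (forall x, f x <= p x) /\ f a = p a.
Proof.
move=> ps; have [q [qs qp qmin]] := sublinear_minimal (sublinear_dir_sublinear ps a).
(* By minimality [q] equals its own lowering in the direction [x]. *)
have qN x : q (- x) = - q x.
  apply/eqP; rewrite eq_le; apply/andP; split.
    rewrite -{1}(qmin _ (sublinear_dir_sublinear qs x)).
      exact: sublinear_dirN.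
    exact: sublinear_dir_le_id.
  by have := sublinearN qs (- x); rewrite opprK; lra.
have qD x y : q (x + y) = q x + q y.
  apply/eqP; rewrite eq_le qs.1 /=.
  by have := qs.1 (x + y) (- y); rewrite addrK qN; lra.
have qZ t x : q (t *: x) = t * q x.
  have [t0|t0] := lerP 0 t; first exact: sublinearZ.
  rewrite -[t]opprK scaleNr qN sublinearZ //; last by rewrite oppr_ge0 ltW.
  by rewrite -mulNr.
have ql : linear_for *%R q by move=> t x y; rewrite qD qZ.
pose f : {scalar V} :=
  HB.pack_for {scalar V} q (GRing.isLinear.Build R V R *%R q ql).
exists f; split=> [x|]; first by apply: le_trans (qp x) _; exact: sublinear_dir_le_id.
(* As [q] lies below the lowering of [p] along [a], its value at [- a] is at most [- p a]. *)
apply/eqP; rewrite eq_le (le_trans (qp a)) ?sublinear_dir_le_id //=.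
by have := le_trans (qp (- a)) (sublinear_dirN ps a); rewrite qN; lra.
Qed.

End HahnBanach.

(** An alias that carries the real vector space structure, kept apart from the complex one on the
    same elements. *)
Definition realified (R : realType) (V : lmodType R[i]) : Type := V.

Section Realified.
Variables (R : realType) (V : lmodType R[i]).
Local Notation VR := (realified V).

HB.instance Definition _ := GRing.Zmodule.copy VR V.

Definition realified_scale (t : R) (v : VR) : VR := t%:C *: (v : V).

Lemma realified_scaleA t c (v : VR) :
  realified_scale t (realified_scale c v) = realified_scale (t * c) v.
Proof. by rewrite /realified_scale scalerA rmorphM. Qed.

Lemma realified_scale1 : left_id 1 realified_scale.
Proof. by move=> v; rewrite /realified_scale scale1r. Qed.

Lemma realified_scaleDr : right_distributive realified_scale +%R.
Proof. by move=> t v w; rewrite /realified_scale scalerDr. Qed.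

Lemma realified_scaleDl (v : VR) : {morph realified_scale^~ v : t c / t + c}.
Proof. by move=> t c; rewrite /realified_scale rmorphD scalerDl. Qed.

HB.instance Definition _ := GRing.Zmodule_isLmodule.Build R VR
  realified_scaleA realified_scale1 realified_scaleDr realified_scaleDl.

End Realified.

(** * States obtained from the distance to the negative cone *)

Section States.
Variables (R : realType) (A : cstarAlgType R).
Local Notation U := (unitization A).
Implicit Types (a b h k x : A) (phi : {scalar A}).

Lemma cpos_upos a : cpos a -> upos (uemb a).
Proof. by case=> b ->; rewrite uembM -ustar_emb; exact: upos_cstar. Qed.

Lemma upos_rnorm_le a c : upos (uemb a) ->
  upos (c%:C *: 1 - uemb a) -> rnorm a <= c.
Proof. by move=> h1 h2; rewrite -unorm_emb; apply: upos_unorm_le. Qed.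

(** A real functional dominated by this distance to - A_+ is at most the norm and is nonnegative on
    positive elements. *)
Definition pos_dist h : R :=
  inf [set rnorm (h + k) | k in [set k | upos (uemb k)]].

Lemma pos_dist_has_inf h :
  has_inf [set rnorm (h + k) | k in [set k | upos (uemb k)]].
Proof.
split; last by exists 0 => _ [k _ <-]; exact: rnorm_ge0.
by exists (rnorm (h + 0)); exists 0 => //=; have := upos_realU A (lexx 0); rewrite scale0r.
Qed.

Lemma pos_dist_le h k : upos (uemb k) -> pos_dist h <= rnorm (h + k).
Proof.
by move=> kp; apply: ge_inf; [case: (pos_dist_has_inf h) | exists k].
Qed.

Lemma pos_dist_ge h c :
  (forall k, upos (uemb k) -> c <= rnorm (h + k)) -> c <= pos_dist h.
Proof.
move=> hc; apply: lb_le_inf; first by case: (pos_dist_has_inf h).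
by move=> _ [k kp <-]; exact: hc.
Qed.

Lemma pos_dist_rnorm h : pos_dist h <= rnorm h.
Proof.
rewrite -{2}[h]addr0; apply: pos_dist_le.
by have := upos_realU A (lexx 0); rewrite scale0r.
Qed.

Lemma pos_distN k : upos (uemb k) -> pos_dist (- k) <= 0.
Proof. by move=> kp; have := pos_dist_le (- k) kp; rewrite addNr rnorm0. Qed.

(** For positive [k], ||a + k|| - a = (||a + k|| - (a + k)) + k is positive, so ||a|| <= ||a + k||:
    the nearest point of the cone is 0. *)
Lemma pos_dist_pos a : upos (uemb a) -> pos_dist a = rnorm a.
Proof.
move=> ap; apply/eqP; rewrite eq_le pos_dist_rnorm /=.
apply: pos_dist_ge => k kp; apply: upos_rnorm_le => //.
have akp := uposD ap kp; rewrite -uembD in akp.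
have := uposD (upos_sub_unorm (upos_sa akp) (lexx _)) kp.
by rewrite unorm_emb uembD opprD addrA subrK.
Qed.

Lemma pos_dist_sublinear : sublinear (pos_dist : realified A -> R).
Proof.
split=> [x y|c x c0].
  rewrite -lerBlDr; apply: pos_dist_ge => k kp.
  rewrite lerBlDr -lerBlDl; apply: pos_dist_ge => l lp.
  rewrite lerBlDl; have klp := uposD kp lp; rewrite -uembD in klp.
  by apply: le_trans (pos_dist_le (x + y : A) klp) _; rewrite addrACA rnormD.
change (pos_dist (c%:C *: (x : A)) <= c * pos_dist x).
have [->|c_neq0] := eqVneq c 0.
  by rewrite mul0r scale0r; apply: le_trans (pos_dist_rnorm _) _; rewrite rnorm0.
have c_gt0 : 0 < c by rewrite lt_def c_neq0.
rewrite mulrC -ler_pdivrMr //; apply: pos_dist_ge => k kp.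
rewrite ler_pdivrMr //; have ckp := uposZ c0 kp; rewrite -uembZ in ckp.
apply: le_trans (pos_dist_le _ ckp) _.
by rewrite -scalerDr rnormZ rnormC ger0_norm // mulrC.
Qed.

(** The root of [uemb k] in the unitization has scalar part of square 0, so it lies in [A] and
    exhibits [k] as b^* b. *)
Lemma states_ge0 phi k : states phi -> upos (uemb k) -> 0 <= phi k.
Proof.
move=> [pp _] /upos_root[[l b] [bs _ b2 _]]; apply: pp; exists b.
have l0 : l = 0.
  by move: b2; rewrite expr2 => -[/eqP + _]; rewrite mulf_eq0 orbb => /eqP.
move: bs b2; rewrite l0 -/(uemb b) ustar_emb => /(@uemb_inj _ A) ->.
by rewrite expr2 -uembM => /(@uemb_inj _ A).
Qed.

Lemma states_le phi a : states phi -> rnorm (phi a) <= rnorm a.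
Proof.
move=> [_ [ub _]]; have [a0|a_neq0] := eqVneq (rnorm a) 0.
  by rewrite (rnorm0_eq0 a0) linear0 !rnorm0.
have a_gt0 : 0 < rnorm a by rewrite lt_def a_neq0 rnorm_ge0.
have ia0 : 0 <= (rnorm a)^-1 by rewrite invr_ge0 ltW.
have : `|phi ((rnorm a)^-1%:C *: a)| <= 1.
  apply: ub; exists ((rnorm a)^-1%:C *: a) => //=.
  by rewrite rnormE lecR rnormZ rnormC ger0_norm // mulVf.
rewrite linearZ /= rnormE -[1]/(1%:C) lecR rnormM rnormC ger0_norm //.
by rewrite mulrC ler_pdivrMr // mul1r.
Qed.

(* Hahn-Banach for the distance to the cone -A_+ yields a real-linear f, which
   is made self-adjoint before being complexified. *)
Lemma state_norming a : upos (uemb a) -> a != 0 ->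
  exists phi, states phi /\ phi a = (rnorm a)%:C.
Proof.
move=> ap a_neq0.
have [f [fle fa]] := hahn_banach_dominated (a : realified A) pos_dist_sublinear.
have fN (x : A) : f (- x : A) = - f x by exact: (raddfN f).
have fD (x y : A) : f (x + y : A) = f x + f y by exact: (raddfD f).
have fZ (t : R) (x : A) : f (t%:C *: x : A) = t * f x by exact: (scalarZ f).
have fx (x : A) : f x <= rnorm x := le_trans (fle x) (pos_dist_rnorm x).
have fpos k : upos (uemb k) -> 0 <= f k.
  by move=> /pos_distN; have := fle (- k : A); rewrite fN; lra.
pose g (x : A) : R := (f x + f (cstar x)) / 2.
have gD x y : g (x + y) = g x + g y by rewrite /g cstarD !fD; ring.
have gZ (t : R) x : g (t%:C *: x) = t * g x.
  by rewrite /g cstarZ conj_Creal ?complex_real // !fZ; ring.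
have gx x : g x <= rnorm x.
  by rewrite /g; have := fx x; have := fx (cstar x); rewrite rnorm_cstar; lra.
pose ph (x : A) : R[i] := g x +i* - g ('i%C *: x).
have phl : linear_for *%R ph.
  move=> [u v] x y; rewrite /ph scalerDr !gD scalerA.
  have gC p q (z : A) : g ((p +i* q) *: z) = p * g z + q * g ('i%C *: z).
    have -> : p +i* q = p%:C + q%:C * 'i%C.
      by apply/eqP; rewrite eq_complex /=; apply/andP; split; apply/eqP; ring.
    by rewrite scalerDl gD -scalerA !gZ.
  have -> : 'i%C * (u +i* v) = (- v) +i* u.
    by apply/eqP; rewrite eq_complex /=; apply/andP; split; apply/eqP; ring.
  rewrite (gC u v x) (gC (- v) u x).
  by apply/eqP; rewrite eq_complex /=; apply/andP; split; apply/eqP; ring.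
pose phi : {scalar A} :=
  HB.pack_for {scalar A} ph (GRing.isLinear.Build R[i] A R[i] *%R ph phl).
have phiE x : phi x = ph x by [].
(* For self-adjoint k, (i k)^* = - i k, so the imaginary part [g] of i k vanishes. *)
have phi_sa k : cstar k = k -> phi k = (f k)%:C.
  move=> ks; rewrite phiE /ph /g cstarZ ks.
  have -> : Num.conj 'i%C = - 'i%C :> R[i] by exact: conjCi.
  rewrite scaleNr fN subrr mul0r oppr0; congr (_ +i* _); lra.
have phi_le x : rnorm (phi x) <= rnorm x.
  have [->|z0] := eqVneq (phi x) 0; first by rewrite rnorm0 rnorm_ge0.
  set z := phi x in z0 *.
  have z_neq0 : `|z| != 0 by rewrite normr_eq0.
  (* A unimodular factor makes the value real: |phi x| = Re (phi (w x)) <= ||w x|| = ||x||. *)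
  pose w : R[i] := Num.conj z / `|z|.
  have wz : w * z = `|z|.
    by rewrite mulrAC [Num.conj z * z]mulrC -normCK expr2 mulfK.
  have w1 : rnorm w = 1.
    by rewrite /rnorm normrM norm_conjC normfV normr_id mulfV.
  have : complex.Re (phi (w *: x)) <= rnorm (w *: x) by exact: gx.
  by rewrite scalarZ -/z wz rnormZ w1 mul1r.
have phia : phi a = (rnorm a)%:C.
  rewrite phi_sa ?fa ?pos_dist_pos //.
  by apply: (@uemb_inj _ A); rewrite -ustar_emb (upos_sa ap).
exists phi; split=> //; split.
  move=> k /cpos_upos kp; rewrite phi_sa ?ler0c ?fpos //.
  by apply: (@uemb_inj _ A); rewrite -ustar_emb (upos_sa kp).
have na : rnorm a != 0 by apply: contra_neq a_neq0 => /rnorm0_eq0.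
have ia0 : 0 <= (rnorm a)^-1 by rewrite invr_ge0 rnorm_ge0.
split=> [_ [x /= x1 <-]|c ub].
  by apply: le_trans x1; rewrite !rnormE lecR.
(* The norm of [phi] is attained at a / ||a||. *)
have <- : `|phi ((rnorm a)^-1%:C *: a)| = 1.
  by rewrite scalarZ phia -rmorphM /= mulVf // normr1.
apply: ub; exists ((rnorm a)^-1%:C *: a) => //=.
by rewrite rnormE rnormZ rnormC ger0_norm // mulVf.
Qed.

End States.

(** * The equivalences *)

Section NormEquality.
Variables (R : realType) (A : cstarAlgType R).
Implicit Types (p q : A) (phi : {scalar A}).

(** The real part must equal t, and then |z| <= t leaves no room for an imaginary part. *)
Lemma complex_real_eq (z : R[i]) t : rnorm z <= t -> t <= complex.Re z -> z = t%:C.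
Proof.
move=> zt tz; have t0 : 0 <= t := le_trans (rnorm_ge0 z) zt.
have := rnorm_Re z; case: z zt tz => a b /= zt tz za.
have at_ : a = t by apply/eqP; rewrite eq_le (le_trans za zt) tz.
have : a ^+ 2 + b ^+ 2 <= t ^+ 2.
  rewrite -[a ^+ 2 + b ^+ 2]sqr_sqrtr ?addr_ge0 ?sqr_ge0 //.
  by rewrite ler_sqr ?nnegrE ?sqrtr_ge0.
rewrite at_ gerDl => b2; have -> : b = 0 by apply/eqP; rewrite -sqrf_eq0 eq_le b2 sqr_ge0.
by [].
Qed.

Lemma sa_emb p : cstar p = p -> ustar (uemb p) = uemb p.
Proof. by move=> ps; rewrite ustar_emb ps. Qed.

Lemma rnorm_csqr p : cstar p = p -> rnorm (csqr p) = rnorm p ^+ 2.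
Proof. by move=> ps; rewrite /csqr -{1}ps rnorm_cstar2. Qed.

Lemma uemb_csqr p : uemb (csqr p) = uemb p ^+ 2.
Proof. by rewrite /csqr uembM expr2. Qed.

Lemma upos_csqr p : cstar p = p -> upos (uemb (csqr p)).
Proof. by move=> ps; rewrite uemb_csqr; apply/upos_sqr/sa_emb. Qed.

Lemma csqrZ t p : csqr (t%:C *: p) = (t ^+ 2)%:C *: csqr p.
Proof. by rewrite /csqr cmulZl cmulZr scalerA -rmorphM expr2. Qed.

Lemma state_csqr phi p : states phi -> cstar p = p ->
  exists t, phi (csqr p) = t%:C /\ 0 <= t <= rnorm p ^+ 2.
Proof.
move=> phis ps; have := states_ge0 phis (upos_csqr ps).
have := states_le (csqr p) phis; rewrite rnorm_csqr //.
case: (phi _) => a b le; rewrite lecE /= => /andP[/eqP b0 a0].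
exists a; split; first by rewrite b0.
by rewrite a0; exact: le_trans (rnorm_Re (a +i* b)) le.
Qed.

(** For a = 0 any state will do; one exists because b^* b is nonzero for some b. *)
Lemma state_norming_exists (a : A) : (exists b : A, b != 0) -> upos (uemb a) ->
  exists phi, states phi /\ phi a = (rnorm a)%:C.
Proof.
move=> [b b0] ap; have [a0|] := eqVneq a 0; last exact: state_norming.
have [||phi [phis _]] := @state_norming R A (cstar b ** b).
- by rewrite uembM -ustar_emb; apply: upos_cstar.
- apply: contra_neq b0 => b0; apply: rnorm0_eq0; apply/eqP.
  by rewrite -sqrf_eq0 -rnorm_cstar2 b0 rnorm0.
by exists phi; split=> //; rewrite a0 linear0 rnorm0.
Qed.

Section Pair.
Variables p q : A.
Hypotheses (ps : cstar p = p) (qs : cstar q = q).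

Lemma common_state_of_norm_add : (exists b : A, b != 0) ->
  rnorm (csqr p + csqr q) = rnorm p ^+ 2 + rnorm q ^+ 2 ->
  exists phi, [/\ states phi, phi (csqr p) = (rnorm p ^+ 2)%:C &
    phi (csqr q) = (rnorm q ^+ 2)%:C].
Proof.
move=> A0 e; have := uposD (upos_csqr ps) (upos_csqr qs).
rewrite -uembD => /(state_norming_exists A0)[phi [phis]].
have [t [ht /andP[_ t1]]] := state_csqr phis ps.
have [c [hc /andP[_ c1]]] := state_csqr phis qs.
rewrite linearD /= ht hc e -rmorphD => /complexI tc.
by exists phi; rewrite ht hc; split=> //; congr _%:C; lra.
Qed.

Lemma norm_add_of_norm_mul : rnorm p = 1 -> rnorm q = 1 -> rnorm (p ** q) = 1 ->
  rnorm (csqr p + csqr q) = rnorm p ^+ 2 + rnorm q ^+ 2.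
Proof.
move=> p1 q1 pq1.
have le2 : rnorm (csqr p + csqr q) <= 2.
  by apply: le_trans (rnormD _ _) _; rewrite !rnorm_csqr // p1 q1; lra.
rewrite p1 q1; apply/eqP; rewrite expr1n eq_le le2 /=.
set t := rnorm _; have t0 : 0 <= t := rnorm_ge0 _.
pose P := uemb p; pose Q := uemb q.
have Ps : ustar P = P by exact: sa_emb.
have Qs : ustar Q = Q by exact: sa_emb.
have h1 : upos (t%:C *: 1 - (P ^+ 2 + Q ^+ 2)).
  rewrite -!uemb_csqr -uembD; apply: upos_sub_unorm; last by rewrite unorm_emb.
  by rewrite uembD ustarD !uemb_csqr (upos_sa (upos_sqr Ps)) (upos_sa (upos_sqr Qs)).
have := upos_conj Q h1; rewrite Qs => h2.
have h3 : upos (((t / 2)%:C *: 1 - Q ^+ 2) ^+ 2).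
  by apply: upos_sqr; rewrite ustarB sa_realU (upos_sa (upos_sqr Qs)).
(* Completes the square in t Q^2 - Q^4. The left side is positive, hence ||P Q||^2 <= t^2 / 4, that
   is, t >= 2. *)
have e : Q * (t%:C *: 1 - (P ^+ 2 + Q ^+ 2)) * Q +
    ((t / 2)%:C *: 1 - Q ^+ 2) ^+ 2 =
    ((t / 2) ^+ 2)%:C *: 1 - ustar (P * Q) * (P * Q).
  have -> : Q * (t%:C *: 1 - (P ^+ 2 + Q ^+ 2)) * Q =
      t%:C *: Q ^+ 2 - Q ^+ 4 - ustar (P * Q) * (P * Q).
    rewrite opprD addrA addrAC !mulrBr !mulrBl realZ_mulUr -scalerAl -expr2.
    by rewrite -[Q * Q ^+ 2]exprS -exprSr ustarM Ps Qs expr2 !mulrA.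
  have -> : ((t / 2)%:C *: 1 - Q ^+ 2) ^+ 2 =
      ((t / 2) ^+ 2)%:C *: 1 - t%:C *: Q ^+ 2 + Q ^+ 4.
    have -> : t%:C *: Q ^+ 2 = (t / 2)%:C *: Q ^+ 2 + (t / 2)%:C *: Q ^+ 2.
      by rewrite -scalerDl -rmorphD /= -splitr.
    rewrite expr2 mulrBr !mulrBl !realZ_mulU realZ_mulUr realZA -expr2 -exprD.
    by rewrite opprB addrACA -opprD addrAC.
  by rewrite addrAC; congr (_ - _); rewrite addrC addrACA subrK subrr addr0.
have := uposD h2 h3; rewrite e => h4.
have := upos_unorm_le (upos_cstar (P * Q)) h4.
rewrite unorm_cstar -uembM unorm_emb pq1 expr1n; nra.
Qed.

Lemma state_mul_eq1 phi : states phi -> rnorm p <= 1 -> rnorm q <= 1 ->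
  phi (csqr p) = 1 -> phi (csqr q) = 1 -> phi (csqr p ** csqr q) = 1.
Proof.
move=> phis p1 q1 phip phiq.
set s := csqr p in phip *; set r := csqr q in phiq *.
pose m : A := (2^-1)%:C *: (s + r).
have le1 (a : A) : cstar a = a -> rnorm a <= 1 -> unorm (1 - uemb (csqr a)) <= 1.
  move=> as_ a1; rewrite -[X in unorm (X - _)]realZ1 uemb_csqr.
  apply: unorm_sub_sqr; rewrite ?sa_emb // unorm_emb.
  by have := rnorm_ge0 a; nra.
have sr1 : rnorm s <= 1 /\ rnorm r <= 1.
  by rewrite !rnorm_csqr // !expr_le1 ?rnorm_ge0.
(* 1 - m is the mean of 1 - p^2 and 1 - q^2, both of norm at most 1. *)
have m1 : unorm (1 - uemb m) <= 1.
  have -> : 1 - uemb m = (2^-1)%:C *: ((1 - uemb s) + (1 - uemb r)).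
    rewrite addrACA -opprD -uembD scalerBr -uembZ -/m; congr (_ - _).
    by rewrite -mulr2n -scalerMnr half_scale2.
  rewrite unormZr ger0_norm ?invr_ge0 // mulrC ler_pdivrMr // mul1r.
  by apply: le_trans (unormD _ _) _; have := le1 p ps p1; have := le1 q qs q1; lra.
have ms : ustar (1 - uemb m) = 1 - uemb m.
  rewrite ustarB ustar1 uembZ ustarZr uembD ustarD.
  by rewrite (upos_sa (upos_csqr ps)) (upos_sa (upos_csqr qs)).
have mm : rnorm (m *+ 2 - m ** m) <= 1.
  rewrite -unorm_emb.
  have -> : uemb (m *+ 2 - m ** m) = 1%:C *: 1 - (1 - uemb m) ^+ 2.
    rewrite realZ1 -[(1 - uemb m) ^+ 2]sqrrN opprB sqrrB1.
    rewrite uembD uembN uembM mulr2n uembD -mulr2n expr2 opprD opprB addrCA subrr.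
    by rewrite addr0 addrC.
  apply: unorm_sub_sqr => //.
  by rewrite expr_le1 ?unorm_ge0.
have phim : phi m = 1.
  rewrite scalarZ linearD /= phip phiq.
  by apply/eqP; rewrite eq_complex /=; apply/andP; split; apply/eqP; lra.
have h4 : complex.Re (phi (m ** m)) >= 1.
  have := le_trans (rnorm_Re _) (le_trans (states_le _ phis) mm).
  by rewrite linearB linearMn /= phim raddfB /=; lra.
have e : m ** m = (4^-1)%:C *: ((s ** s + r ** r) + (s ** r + r ** s)).
  rewrite /m cmulZl cmulZr scalerA -rmorphM cmulDr !cmulDl; congr (_%:C *: _); first by field.
  by rewrite [RHS](AC (2*2) ((1*4)*(3*2))).
have bnd (a b : A) : rnorm a <= 1 -> rnorm b <= 1 ->
    rnorm (phi (a ** b)) <= 1 /\ complex.Re (phi (a ** b)) <= 1.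
  move=> a1 b1; have : rnorm (phi (a ** b)) <= 1.
    apply: le_trans (states_le _ phis) _; apply: le_trans (rnorm_cmul _ _) _.
    by rewrite mulr_ile1 ?rnorm_ge0.
  by move=> h; split=> //; apply: le_trans (rnorm_Re _) h.
(* Four real parts, each at most 1, have sum at least 4; in particular that of phi(s r) is at least
   1. *)
apply: complex_real_eq; first by case: (bnd s r); case: sr1.
move: h4; rewrite e scalarZ !linearD /=.
case: sr1 => s1 r1.
have [_] := bnd s s s1 s1; have [_] := bnd r r r1 r1; have [_] := bnd r s r1 s1.
case: (phi (s ** s)) => ? ?; case: (phi (r ** r)) => ? ?.
case: (phi (s ** r)) => ? ?; case: (phi (r ** s)) => ? ? /=.
by lra.
Qed.

(** The state gives ||p||^2 ||q||^2 <= ||p (p q) q|| <= ||p|| ||p q|| ||q||. If ||p q|| < ||p||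
    ||q||, both factors are positive and cancelling them is contradictory. *)
Lemma norm_mul_of_state phi : states phi ->
  phi (csqr p ** csqr q) = (rnorm p ^+ 2 * rnorm q ^+ 2)%:C ->
  rnorm (p ** q) = rnorm p * rnorm q.
Proof.
move=> phis e; apply/eqP; rewrite eq_le rnorm_cmul /=.
have := states_le (csqr p ** csqr q) phis.
rewrite e rnormC ger0_norm ?mulr_ge0 ?exprn_ge0 ?rnorm_ge0 //.
have -> : csqr p ** csqr q = p ** (p ** q) ** q by rewrite /csqr !cmulA.
move=> h; have := le_trans h (rnorm_cmul _ _).
move/le_trans => /(_ _ (ler_wpM2r (rnorm_ge0 q) (rnorm_cmul _ _))).
have := rnorm_ge0 p; have := rnorm_ge0 q; have := rnorm_ge0 (p ** q).
move: (rnorm p) (rnorm q) (rnorm (p ** q)) => a b c c0 b0 a0 h'.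
rewrite leNgt; apply/negP => cab.
have a1 : 0 < a by rewrite lt_def a0 andbT; apply/eqP => a_0; move: cab; rewrite a_0; nra.
have b1 : 0 < b by rewrite lt_def b0 andbT; apply/eqP => b_0; move: cab; rewrite b_0; nra.
have ab := mulr_gt0 a1 b1.
have : (a * b) * c < (a * b) * (a * b) by rewrite ltr_pM2l.
by nra.
Qed.

Lemma norm_add_of_state phi : states phi ->
  phi (csqr p + csqr q) = (rnorm p ^+ 2 + rnorm q ^+ 2)%:C ->
  rnorm (csqr p + csqr q) = rnorm p ^+ 2 + rnorm q ^+ 2.
Proof.
move=> phis e; apply/eqP; rewrite eq_le; apply/andP; split.
  by apply: le_trans (rnormD _ _) _; rewrite !rnorm_csqr.
have := states_le (csqr p + csqr q) phis.
by rewrite e rnormC ger0_norm // addr_ge0 // exprn_ge0 ?rnorm_ge0.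
Qed.

End Pair.

Lemma sa_normalize p : cstar p = p -> p != 0 ->
  exists p', [/\ cstar p' = p', rnorm p' = 1 & p = (rnorm p)%:C *: p'].
Proof.
move=> ps p0; have np : rnorm p != 0 by apply: contra_neq p0 => /rnorm0_eq0.
exists ((rnorm p)^-1%:C *: p); split.
- by rewrite cstarZ ps conj_Creal ?complex_real.
- by rewrite rnormZ rnormC ger0_norm ?invr_ge0 ?rnorm_ge0 // mulVf.
- by rewrite scalerA -rmorphM /= mulfV // scale1r.
Qed.

(** If p or q is 0, the norm of p^2 + q^2 is trivially additive; otherwise both are scaled to norm
    1. *)
Lemma common_state_of_norm_mul p q : cstar p = p -> cstar q = q ->
  (exists b : A, b != 0) -> rnorm (p ** q) = rnorm p * rnorm q ->
  exists phi, [/\ states phi, phi (csqr p) = (rnorm p ^+ 2)%:C &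
    phi (csqr q) = (rnorm q ^+ 2)%:C].
Proof.
move=> ps qs A0 e.
have [p0|p_neq0] := eqVneq p 0.
  apply: common_state_of_norm_add => //.
  by rewrite p0 /csqr cmul0 add0r rnorm0 expr0n add0r -/(csqr q) rnorm_csqr.
have [q0|q_neq0] := eqVneq q 0.
  apply: common_state_of_norm_add => //.
  by rewrite q0 /csqr cmul0 addr0 rnorm0 expr0n addr0 -/(csqr p) rnorm_csqr.
have [p' [p's p'1 pe]] := sa_normalize ps p_neq0.
have [q' [q's q'1 qe]] := sa_normalize qs q_neq0.
have ab : rnorm p * rnorm q != 0.
  by rewrite mulf_neq0 //; [apply: contra_neq p_neq0|apply: contra_neq q_neq0];
     move/rnorm0_eq0.
have pq1 : rnorm (p' ** q') = 1.
  apply: (mulfI ab); rewrite mulr1 -[RHS]e [in RHS]pe [in RHS]qe cmulZl cmulZr !rnormZ !rnormC.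
  by rewrite !ger0_norm ?rnorm_ge0 // mulrA.
have := norm_add_of_norm_mul p's q's p'1 q'1 pq1.
case/(common_state_of_norm_add p's q's A0) => phi [phis]; rewrite p'1 q'1 expr1n => hp hq.
exists phi; split=> //.
  by rewrite [in LHS]pe csqrZ scalarZ hp mulr1.
by rewrite [in LHS]qe csqrZ scalarZ hq mulr1.
Qed.

Lemma state_mul_of_common_state p q phi : cstar p = p -> cstar q = q ->
  states phi -> phi (csqr p) = (rnorm p ^+ 2)%:C ->
  phi (csqr q) = (rnorm q ^+ 2)%:C ->
  phi (csqr p ** csqr q) = (rnorm p ^+ 2 * rnorm q ^+ 2)%:C.
Proof.
move=> ps qs phis hp hq.
have [p0|p_neq0] := eqVneq p 0.
  by rewrite p0 /csqr !cmul0l linear0 rnorm0 expr0n mul0r.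
have [q0|q_neq0] := eqVneq q 0.
  by rewrite q0 /csqr !cmul0 linear0 rnorm0 expr0n mulr0.
have norm2 (a : A) : a != 0 -> (rnorm a ^+ 2)%:C != 0 :> R[i].
  move=> a0; rewrite eq_complex /= eqxx andbT expf_neq0 //.
  by apply: contra_neq a0 => /rnorm0_eq0.
have [p' [p's p'1 pe]] := sa_normalize ps p_neq0.
have [q' [q's q'1 qe]] := sa_normalize qs q_neq0.
have hp' : phi (csqr p') = 1.
  by apply: (mulfI (norm2 p p_neq0)); rewrite mulr1 -[RHS]hp [in RHS]pe csqrZ scalarZ.
have hq' : phi (csqr q') = 1.
  by apply: (mulfI (norm2 q q_neq0)); rewrite mulr1 -[RHS]hq [in RHS]qe csqrZ scalarZ.
have h := state_mul_eq1 p's q's phis.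
rewrite [in LHS]pe [in LHS]qe !csqrZ cmulZl cmulZr !scalarZ h ?p'1 ?q'1 //.
by rewrite mulr1 -rmorphM.
Qed.

(** The default value 0 is itself of the form b^* b. *)
Lemma cpos_csqrt (a : A) : cpos (csqrt a).
Proof.
rewrite /csqrt; case: xgetP => [b _ []//|_].
by exists 0; rewrite cmul0.
Qed.

Lemma cpos_sa (a : A) : cpos a -> cstar a = a.
Proof. by case=> b ->; rewrite cstarM cstarK. Qed.

End NormEquality.

Theorem proposition2p4 (R : realType) (A : cstarAlgType R)
    (A_neq0 : exists a : A, a != 0)
    (E : preHilbertModType A) (x y : E) :
  [<->
    `|csqr (mabs x) + csqr (mabs y)| = mnorm x ^+ 2 + mnorm y ^+ 2 ;
    `|mabs x ** mabs y| = mnorm x * mnorm y ;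
    norming_states (csqr (mabs x)) `&` norming_states (csqr (mabs y)) !=set0 ;
    num_range (csqr (mabs x) ** csqr (mabs y))
      (mnorm x ^+ 2 * mnorm y ^+ 2) ;
    num_range (csqr (mabs x) + csqr (mabs y))
      (mnorm x ^+ 2 + mnorm y ^+ 2) ].
Proof.
have ps : cstar (mabs x) = mabs x by exact/cpos_sa/cpos_csqrt.
have qs : cstar (mabs y) = mabs y by exact/cpos_sa/cpos_csqrt.
rewrite /mnorm; move: (mabs x) (mabs y) ps qs => p q ps qs.
rewrite !(rnormE p) !(rnormE q) !(rnormE (_ + _)) !(rnormE (_ ** _)).
rewrite -!rmorphXn -!rmorphD -!rmorphM /=.
have norming (phi : {scalar A}) a : cstar a = a -> states phi ->
    `|phi (csqr a)| = `|csqr a| <-> phi (csqr a) = (rnorm a ^+ 2)%:C.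
  move=> as_ phis; have [t [ht /andP[t0 _]]] := state_csqr phis as_.
  rewrite ht !rnormE rnorm_csqr // rnormC ger0_norm //.
(* The step from (iv) to (v) goes back through the norm equality (ii) and may change the state. *)
have common_mul (phi : {scalar A}) : states phi ->
    phi (csqr p ** csqr q) = (rnorm p ^+ 2 * rnorm q ^+ 2)%:C ->
    exists phi : {scalar A}, [/\ states phi, phi (csqr p) = (rnorm p ^+ 2)%:C &
      phi (csqr q) = (rnorm q ^+ 2)%:C].
  move=> phis /(norm_mul_of_state phis); exact: common_state_of_norm_mul.
(* The implications form the cycle (i), (ii), (iii), (iv), (v), (i). *)
tfae.
- move=> /complexI /(common_state_of_norm_add ps qs A_neq0)[phi [phis hp hq]].
  congr _%:C; apply: (norm_mul_of_state phis).
  exact: state_mul_of_common_state.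
- move=> /complexI /(common_state_of_norm_mul ps qs A_neq0)[phi [phis hp hq]].
  by exists phi; split; split=> //; apply/norming.
- move=> [phi [[phis /(norming _ _ ps phis) hp] [_ /(norming _ _ qs phis) hq]]].
  by exists phi => //; exact: state_mul_of_common_state.
- move=> [phi phis /(common_mul _ phis)[psi [psis hp hq]]].
  by exists psi => //; rewrite linearD /= hp hq -rmorphD.
- move=> [phi phis e]; congr _%:C; exact: norm_add_of_state phis e.
Qed.
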